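(* Consider the semi-discrete Vlasov--Maxwell equations of motion with perfect conductor boundary conditions for $\tilde{\mathbf{u}}=(\boldsymbol\Xi,\mathbf{V},\tilde{\mathbf{e}},\tilde{\mathbf{b}})$ (with $\mathsf{D}\tilde{\mathbf{b}}=0$), $$\dot{\boldsymbol\Xi}=\mathbb{N}^\top(\boldsymbol\Xi)\mathbf{V},\qquad \dot{\mathbf{V}}=\mathbb{W}_{\frac qm}\mathbb{N}(\boldsymbol\Xi)\left(\tilde{\mathbb{\Lambda}}^1(\boldsymbol\Xi)\tilde{\mathbf{e}}+\tilde{\mathbb{B}}(\boldsymbol\Xi,\tilde{\mathbf{b}})\mathbb{N}^\top(\boldsymbol\Xi)\mathbf{V}\right),$$ $$\tilde{\mathsf{M}}_1\dot{\tilde{\mathbf{e}}}=\mathsf{C}^\top\tilde{\mathsf{M}}_2\tilde{\mathbf{b}}-\tilde{\mathbb{\Lambda}}^1(\boldsymbol\Xi)^\top\mathbb{N}^\top(\boldsymbol\Xi)\mathbb{W}_q\mathbf{V},\qquad \dot{\tilde{\mathbf{b}}}=-\mathsf{C}\tilde{\mathbf{e}} .$$ These can be expressed as the Poisson system $$\frac{d\tilde{\mathbf{u}}}{dt}=\mathbb{J}(\tilde{\mathbf{u}})\,D\tilde{\mathcal{H}}_h(\tilde{\mathbf{u}}),\qquad \tilde{\mathcal{H}}_h=\tfrac12\mathbf{V}^\top\mathbb{W}_m\mathbf{V}+\tfrac12\tilde{\mathbf{e}}^\top\tilde{\mathsf{M}}_1\tilde{\mathbf{e}}+\tfrac12\tilde{\mathbf{b}}^\top\tilde{\mathsf{M}}_2\tilde{\mathbf{b}},$$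 with the Poisson matrix $$\mathbb{J}(\tilde{\mathbf{u}})=\begin{pmatrix}0&\mathbb{N}^\top\mathbb{W}_m^{-1}&0&0\\-\mathbb{W}_m^{-1}\mathbb{N}&\mathbb{W}_{\frac qm}\mathbb{N}\tilde{\mathbb{B}}(\boldsymbol\Xi,\tilde{\mathbf{b}})\mathbb{N}^\top\mathbb{W}_m^{-1}&\mathbb{W}_{\frac qm}\mathbb{N}\tilde{\mathbb{\Lambda}}^1\tilde{\mathsf{M}}_1^{-1}&0\\0&-\tilde{\mathsf{M}}_1^{-1}(\tilde{\mathbb{\Lambda}}^1)^\top\mathbb{N}^\top\mathbb{W}_{\frac qm}&0&\tilde{\mathsf{M}}_1^{-1}\mathsf{C}^\top\\0&0&-\mathsf{C}\tilde{\mathsf{M}}_1^{-1}&0\end{pmatrix}$$ (where $\mathbb{N}=\mathbb{N}(\boldsymbol\Xi)$, $\tilde{\mathbb{\Lambda}}^1=\tilde{\mathbb{\Lambda}}^1(\boldsymbol\Xi)$); that is, the equations of motion coincide with this system, and $\mathbb{J}$ is a Poisson matrix: it is skew-symmetric and satisfies the Jacobi identity.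
   Context: $F:[0,1]^3\to\Omega$ is a smooth bijective coordinate transformation with $J_F=\det DF\neq0$, $N=DF^{-\top}$, $G_m=DF^\top DF$; the logical coordinates $\xi_2,\xi_3$ are periodic directions and $\xi_1\in[0,1]$ is the bounded direction. Spline bases with perfect conductor boundary conditions. $\tilde{\boldsymbol\Lambda}^k(\boldsymbol\xi)=\operatorname{diag}(\tilde\Lambda^{k,1},\tilde\Lambda^{k,2},\tilde\Lambda^{k,3})$, $k=1,2$, are block-diagonal with three rows, each $\tilde\Lambda^{k,i}$ being a row vector of tensor-product splines: $\tilde\Lambda^{1,i}$ has degree $p-1$ in direction $i$ and $p$ in the two others; $\tilde\Lambda^{2,i}$ has degree $p$ in direction $i$ and $p-1$ in the two others; $\tilde\Lambda^3$ has degree $p-1$ in all directions. In directions $\xi_2,\xi_3$ the univariate splines are the uniform 1-periodic B-splines; in direction $\xi_1$ they are the (nonzero) B-splines of that degree on $[0,1]$ for the uniform clamped knot sequence, where for degree $p$ the first and the last one (the only ones not vanishing at $\xi_1=0$ or $\xi_1=1$) are removed. Thus $\tilde\Lambda^{1,2}=\tilde\Lambda^{1,3}=\tilde\Lambda^{2,1}=0$ at $\xi_1\in\{0,1\}$, which encodes the perfect conductor conditions $\tilde{\mathbf{E}}\times\tilde{\mathbf{n}}=0$, $\tilde{\mathbf{B}}\cdot\tilde{\mathbf{n}}=0$. The matrices $\mathsf{C},\mathsf{D}$ are the discrete curl and divergence matrices, determined by $\nabla_{\boldsymbol\xi}\times\tilde{\boldsymbol\Lambda}^1=\tilde{\boldsymbol\Lambda}^2\mathsf{C}$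 and $\nabla_{\boldsymbol\xi}\cdot\tilde{\boldsymbol\Lambda}^2=\tilde\Lambda^3\mathsf{D}$ (operators acting on columns). The discrete fields are $\tilde{\mathbf{E}}_h=\tilde{\boldsymbol\Lambda}^1\tilde{\mathbf{e}}$, $\tilde{\mathbf{B}}_h=\tilde{\boldsymbol\Lambda}^2\tilde{\mathbf{b}}$. The mass matrices are $$\tilde{\mathsf{M}}_1=\int_{[0,1]^3}(\tilde{\boldsymbol\Lambda}^1)^\top G_m^{-1}\tilde{\boldsymbol\Lambda}^1|J_F|\,d\boldsymbol\xi,\qquad \tilde{\mathsf{M}}_2=\int_{[0,1]^3}(\tilde{\boldsymbol\Lambda}^2)^\top G_m\tilde{\boldsymbol\Lambda}^2\frac1{|J_F|}\,d\boldsymbol\xi .$$ Particles. There are $N_p$ particles with logical positions $\boldsymbol\Xi=(\boldsymbol\xi_1,\dots,\boldsymbol\xi_{N_p})$ and velocities $\mathbf{V}=(\mathbf{v}_1,\dots,\mathbf{v}_{N_p})\in\mathbb{R}^{3N_p}$, nonzero weights $\omega_p$, charges $q_p$, masses $m_p>0$. $\mathbb{W}_q=\operatorname{diag}(\omega_pq_p)\otimes\mathbb{I}_3$, $\mathbb{W}_m=\operatorname{diag}(\omega_pm_p)\otimes\mathbb{I}_3$, $\mathbb{W}_{\frac qm}=\operatorname{diag}(q_p/m_p)\otimes\mathbb{I}_3$. $\mathbb{N}(\boldsymbol\Xi)$ is block-diagonal with blocks $N(\boldsymbol\xi_p)$; $\tilde{\mathbb{\Lambda}}^1(\boldsymbol\Xi)$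 stacks the $3$-row blocks $\tilde{\boldsymbol\Lambda}^1(\boldsymbol\xi_p)$; $\tilde{\mathbb{B}}(\boldsymbol\Xi,\tilde{\mathbf{b}})$ is the $3N_p\times3N_p$ block-diagonal matrix with blocks $$\begin{pmatrix}0&\tilde B_{3}&-\tilde B_{2}\\-\tilde B_{3}&0&\tilde B_{1}\\\tilde B_{2}&-\tilde B_{1}&0\end{pmatrix}(\boldsymbol\xi_p),\qquad \tilde B_{k}(\boldsymbol\xi)=\sum_i\tilde b_{i,k}\tilde\Lambda^{2,k}_i(\boldsymbol\xi).$$ $D\tilde{\mathcal{H}}_h$ denotes the gradient, $D\tilde{\mathcal{H}}_h=(0,\mathbb{W}_m\mathbf{V},\tilde{\mathsf{M}}_1\tilde{\mathbf{e}},\tilde{\mathsf{M}}_2\tilde{\mathbf{b}})^\top$. The Jacobi identity for $\mathbb{J}$ is $$\sum_l\left(\frac{\partial\mathbb{J}_{ij}}{\partial\tilde u_l}\mathbb{J}_{lk}+\frac{\partial\mathbb{J}_{jk}}{\partial\tilde u_l}\mathbb{J}_{li}+\frac{\partial\mathbb{J}_{ki}}{\partial\tilde u_l}\mathbb{J}_{lj}\right)=0\quad\text{for all }i,j,k,$$ required at all states $\tilde{\mathbf{u}}$ with $\mathsf{D}\tilde{\mathbf{b}}=0$ at which the entries of $\mathbb{J}$ are differentiable (i.e. particle positions away from spline knots where the splines are not smooth). *)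

(* Defs.v *)
From HB Require Import structures.
From mathcomp Require Export all_boot all_order all_algebra.
From mathcomp Require Export all_classical all_reals all_analysis.
Export Order.TTheory GRing.Theory Num.Theory.
Export numFieldNormedType.Exports.

Set Implicit Arguments.
Unset Strict Implicit.
Unset Printing Implicit Defensive.

Local Open Scope classical_set_scope.
Local Open Scope ring_scope.

(* Points of the logical domain are row vectors, as the library's [jacobian]
   expects.  Components are numbered 0, 1, 2 and 'I_3 is a cyclic group, so
   that i, i + 1, i + 2 run through a positively oriented frame.  Direction 0
   is the bounded one; directions 1 and 2 are the periodic ones. *)

Section Geometry.
Context {R : realType}.

Definition cube : set 'rV[R]_3 := [set xi | forall d, 0 <= xi 0 d <= 1].

(* The cube without the faces xi_d = 1 of the periodic directions, which are
   the seam along which the map may close up. *)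
Definition fundamental_cube : set 'rV[R]_3 :=
  cube `&` [set xi | forall d, d != ord0 -> xi 0 d < 1].

(* C^infinity: every iterated directional derivative is differentiable. *)
Definition smooth_on (V W : normedModType R) (U : set V) (f : V -> W) : Prop :=
  forall (vs : seq V) (x : V), U x ->
    differentiable (foldr (fun v g => 'D_v g) f vs) x.

(* [jacobian] acts on row vectors from the right: it is the transpose of DF. *)
Definition DF (F : 'rV[R]_3 -> 'rV[R]_3) (xi : 'rV[R]_3) : 'M[R]_3 :=
  (jacobian F xi)^T.
Definition JF F xi : R := \det (DF F xi).
Definition Nmx F xi : 'M[R]_3 := (invmx (DF F xi))^T.
Definition Gm F xi : 'M[R]_3 := (DF F xi)^T *m DF F xi.

(* Smoothness on the closed cube means smoothness on a neighbourhood of it.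
   Injectivity is only required up to the seam: this covers maps that are
   injective on the whole cube as well as maps that are genuinely periodic in
   the last two coordinates (tori, cylinders). *)
Definition coordinate_map (F : 'rV[R]_3 -> 'rV[R]_3) (Omega : set 'rV[R]_3) :=
  [/\ exists U, [/\ open U, cube `<=` U & smooth_on U F],
      F @` cube = Omega,
      {in fundamental_cube &, injective F} &
      forall xi, cube xi -> JF F xi != 0].

Definition partial (f : 'rV[R]_3 -> 'cV[R]_3) (j i : 'I_3) (xi : 'rV[R]_3) : R :=
  'D_(delta_mx 0 j) (fun x => f x i 0) xi.

Definition curl (f : 'rV[R]_3 -> 'cV[R]_3) (xi : 'rV[R]_3) : 'cV[R]_3 :=
  \col_i (partial f (i + 1) (i + 2) xi - partial f (i + 2) (i + 1) xi).

Definition divergence (f : 'rV[R]_3 -> 'cV[R]_3) (xi : 'rV[R]_3) : R :=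
  \sum_i partial f i i xi.

(* The matrix of v |-> v x B. *)
Definition rot_mx (B : 'cV[R]_3) : 'M[R]_3 :=
  \matrix_(i, j) (if j == i + 1 then B (i + 2) 0
                  else if j == i + 2 then - B (i + 1) 0 else 0).

Definition point3 (x : R * R * R) : 'rV[R]_3 :=
  \row_d [:: x.1.1; x.1.2; x.2]`_d.

Definition integral_cube (f : 'rV[R]_3 -> R) : R :=
  \int[((@lebesgue_measure R \x @lebesgue_measure R) \x
       @lebesgue_measure R)%E]_(x in (`[0, 1] `*` `[0, 1]) `*` `[0, 1]) f (point3 x).

End Geometry.

Section Univariate.
Context {R : realType}.

(* Cox-de Boor recursion for the i-th B-spline of degree d on the knots t;
   0 / 0 = 0 as division by zero returns 0 here.  Degree-0 splines are
   right-continuous, except that the cell ending at 1 contains 1. *)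
Fixpoint bspline (t : nat -> R) (d i : nat) (x : R) : R :=
  if d is d'.+1 then
    (x - t i) / (t (i + d)%N - t i) * bspline t d' i x +
    (t (i + d).+1 - x) / (t (i + d).+1 - t i.+1) * bspline t d' i.+1 x
  else ((t i <= x < t i.+1) || [&& x == 1, t i < 1 & t i.+1 == 1])%:R.

Definition uniform_knot (n d i : nat) : R := (i%:R - d%:R) / n%:R.

(* n cells on [0, 1], end knots of multiplicity d + 1; i < n + d. *)
Definition clamped_bspline (n d i : nat) (x : R) : R :=
  bspline (fun k => Num.min 1 (Num.max 0 (uniform_knot n d k))) d i x.

(* Sum of the translates by integers of one uniform B-spline: for x reduced to
   [0, 1[ only the splines with index < n + d on the uniform knots -d/n,
   (1-d)/n, ... contribute, and translation by 1 shifts the index by n. *)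
Definition periodic_bspline (n d j : nat) (x : R) : R :=
  \sum_(i < n + d | (i == j %[mod n])%N)
    bspline (uniform_knot n d) d i (x - (Num.floor x)%:~R).

(* The splines in direction dir, of degree p - 1 if low and p otherwise.  In
   the bounded direction the clamped splines number n + p - 1 for degree p - 1,
   and n + p for degree p, of which the first and the last are removed. *)
Definition spline_count (n p : nat) (dir : 'I_3) (low : bool) : nat :=
  if dir == ord0 then (if low then n + p - 1 else n + p - 2)%N else n.

Definition spline (n p : nat) (dir : 'I_3) (low : bool) (i : nat) (x : R) : R :=
  if dir == ord0 then
    if low then clamped_bspline n p.-1 i x else clamped_bspline n p i.+1 x
  else periodic_bspline n (if low then p.-1 else p) i x.

End Univariate.

Section Splines.
Context {R : realType} (p : nat) (n : 'I_3 -> nat).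

Definition tensor_index (low : 'I_3 -> bool) : finType :=
  {dffun forall d : 'I_3, 'I_(spline_count (n d) p d (low d))}.

Definition tensor_spline (low : 'I_3 -> bool) (f : tensor_index low)
    (xi : 'rV[R]_3) : R :=
  \prod_d spline (n d) p d (low d) (f d) (xi 0 d).

(* low i d tells whether component i has degree p - 1 in direction d. *)
Definition vector_index (low : 'I_3 -> 'I_3 -> bool) : finType :=
  {i : 'I_3 & tensor_index (low i)}.

Definition vector_basis (low : 'I_3 -> 'I_3 -> bool) (xi : 'rV[R]_3) :
    'M[R]_(3, #|vector_index low|) :=
  \matrix_(i, j) (if tag (enum_val j) == i
                  then tensor_spline (tagged (enum_val j)) xi else 0).

Definition low1 (i d : 'I_3) : bool := d == i.
Definition low2 (i d : 'I_3) : bool := d != i.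
Definition low3 (d : 'I_3) : bool := true.

Definition dim1 : nat := #|vector_index low1|.
Definition dim2 : nat := #|vector_index low2|.
Definition dim3 : nat := #|tensor_index low3|.

Definition Lambda1 (xi : 'rV[R]_3) : 'M[R]_(3, dim1) := vector_basis low1 xi.
Definition Lambda2 (xi : 'rV[R]_3) : 'M[R]_(3, dim2) := vector_basis low2 xi.
Definition Lambda3 (xi : 'rV[R]_3) : 'rV[R]_dim3 :=
  \row_j tensor_spline (enum_val j) xi.

(* The defining identities of C and D, for every spline field and at every
   point of the cube where that field is differentiable. *)
Definition discrete_curl (C : 'M[R]_(dim2, dim1)) : Prop :=
  forall (e : 'cV[R]_dim1) (xi : 'rV[R]_3), cube xi ->
    differentiable (fun x => Lambda1 x *m e) xi ->
    curl (fun x => Lambda1 x *m e) xi = Lambda2 xi *m (C *m e).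

Definition discrete_div (D : 'M[R]_(dim3, dim2)) : Prop :=
  forall (b : 'cV[R]_dim2) (xi : 'rV[R]_3), cube xi ->
    differentiable (fun x => Lambda2 x *m b) xi ->
    divergence (fun x => Lambda2 x *m b) xi = (Lambda3 xi *m (D *m b)) 0 0.

Definition mass1 (F : 'rV[R]_3 -> 'rV[R]_3) : 'M[R]_dim1 :=
  \matrix_(i, j) integral_cube (fun xi =>
    ((Lambda1 xi)^T *m invmx (Gm F xi) *m Lambda1 xi) i j * `|JF F xi|).

Definition mass2 (F : 'rV[R]_3 -> 'rV[R]_3) : 'M[R]_dim2 :=
  \matrix_(i, j) integral_cube (fun xi =>
    ((Lambda2 xi)^T *m Gm F xi *m Lambda2 xi) i j * `|JF F xi|^-1).

End Splines.

Section VlasovMaxwell.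
Context {R : realType} (p : nat) (n : 'I_3 -> nat).
Context (F : 'rV[R]_3 -> 'rV[R]_3) (Np : nat) (omega q m : 'I_Np -> R).
Context (C : 'M[R]_(dim2 p n, dim1 p n)) (D : 'M[R]_(dim3 p n, dim2 p n)).

Local Notation d1 := (dim1 p n).
Local Notation d2 := (dim2 p n).
Local Notation dP := (\sum_(k < Np) 3)%N.

(* A state is the column (Xi, V, e, b). *)
Definition state_dim : nat := ((dP + dP) + (d1 + d2))%N.
Local Notation state := 'cV[R]_state_dim.

Definition st_Xi (u : state) : 'cV[R]_dP := usubmx (usubmx u).
Definition st_V (u : state) : 'cV[R]_dP := dsubmx (usubmx u).
Definition st_e (u : state) : 'cV[R]_d1 := usubmx (dsubmx u).
Definition st_b (u : state) : 'cV[R]_d2 := dsubmx (dsubmx u).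

Definition position (Xi : 'cV[R]_dP) (k : 'I_Np) : 'rV[R]_3 :=
  (submxcol Xi k)^T.

Definition W_q : 'M[R]_dP := \mxdiag_(k < Np) (omega k * q k)%:M.
Definition W_m : 'M[R]_dP := \mxdiag_(k < Np) (omega k * m k)%:M.
Definition W_qm : 'M[R]_dP := \mxdiag_(k < Np) (q k / m k)%:M.

Definition NN (Xi : 'cV[R]_dP) : 'M[R]_dP :=
  \mxdiag_(k < Np) Nmx F (position Xi k).
Definition LL1 (Xi : 'cV[R]_dP) : 'M[R]_(dP, d1) :=
  \mxcol_(k < Np) Lambda1 p n (position Xi k).
Definition BB (Xi : 'cV[R]_dP) (b : 'cV[R]_d2) : 'M[R]_dP :=
  \mxdiag_(k < Np) rot_mx (Lambda2 p n (position Xi k) *m b).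

Local Notation M1 := (mass1 p n F).
Local Notation M2 := (mass2 p n F).

Definition hamiltonian (u : state) : R :=
  2^-1 * ((st_V u)^T *m W_m *m st_V u) 0 0
  + 2^-1 * ((st_e u)^T *m M1 *m st_e u) 0 0
  + 2^-1 * ((st_b u)^T *m M2 *m st_b u) 0 0.

Definition poisson_mx (u : state) : 'M[R]_state_dim :=
  let N := NN (st_Xi u) in
  let L := LL1 (st_Xi u) in
  let B := BB (st_Xi u) (st_b u) in
  block_mx
    (block_mx 0                      (N^T *m invmx W_m)
              (- (invmx W_m *m N))   (W_qm *m N *m B *m N^T *m invmx W_m))
    (block_mx 0                          0
              (W_qm *m N *m L *m invmx M1) 0)
    (block_mx 0    (- (invmx M1 *m L^T *m N^T *m W_qm))
              0    0)
    (block_mx 0                    (invmx M1 *m C^T)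
              (- (C *m invmx M1))  0).

Definition admissible (u : state) : Prop :=
  (forall k, cube (position (st_Xi u) k)) /\ D *m st_b u = 0.

(* The equations of motion, as a relation between a state u and its time
   derivative du. *)
Definition equations_of_motion (u du : state) : Prop :=
  let N := NN (st_Xi u) in
  let L := LL1 (st_Xi u) in
  let B := BB (st_Xi u) (st_b u) in
  [/\ st_Xi du = N^T *m st_V u,
      st_V du = W_qm *m N *m (L *m st_e u + B *m N^T *m st_V u),
      M1 *m st_e du = C^T *m M2 *m st_b u - L^T *m N^T *m W_q *m st_V u &
      st_b du = - (C *m st_e u)].

End VlasovMaxwell.

Section Systems.
Context {R : realType} (d : nat).

Definition gradient (H : 'cV[R]_d -> R) (u : 'cV[R]_d) : 'cV[R]_d :=
  \col_i 'D_(delta_mx i 0) H u.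

Definition solution (eqn : 'cV[R]_d -> 'cV[R]_d -> Prop) (T : set R)
    (u : R -> 'cV[R]_d) : Prop :=
  forall t, T t -> derivable u t 1 /\ eqn (u t) (derive1 u t).

Definition jacobi_at (J : 'cV[R]_d -> 'M[R]_d) (u : 'cV[R]_d) : Prop :=
  forall i j k : 'I_d,
    \sum_l ('D_(delta_mx l 0) (fun v => J v i j) u * J u l k
            + 'D_(delta_mx l 0) (fun v => J v j k) u * J u l i
            + 'D_(delta_mx l 0) (fun v => J v k i) u * J u l j) = 0.

End Systems.

(* Main.v *)
Require Import Defs.
From mathcomp Require Import perm measurable_realfun ring lra zify.

(** Three facts are proved: the equations of motion are the system driven by J,
    J is skew-symmetric, and J satisfies the Jacobi identity.

    The gradient of the Hamiltonian is (0, W_m V, M_1 e, M_2 b), and each line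
    of J times this gradient is the corresponding equation of motion, provided
    that M_1 is invertible: the equation for e only determines M_1 de/dt.  The
    invertibility of M_1 ([mass1_unit]) is the analytic half of the proof.  The
    quadratic form of M_1 integrates the square of a spline field for a metric
    that is positive definite at each point of the cube, so a null vector of M_1
    gives a spline field that vanishes almost everywhere; as splines are
    right-continuous, it vanishes everywhere on [0,1)^3.  That its coefficients
    are then zero comes down to the local linear independence of univariate
    B-splines ([bspline_dual]).  On one knot cell, Marsden's identity
    ([marsden_identity]) expands (x - tau)^d in the d + 1 splines that live
    there; since the matrix of the numbers (x_s - tau_r)^d is invertible (two
    Vandermonde matrices and binomial coefficients), so is the matrix of the
    values of the splines at d + 1 points, and its inverse provides functionals
    dual to the splines.  Products of such functionals isolate the coefficients
    of tensor product splines ([vector_basis_free]).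

    For skew-symmetry and the Jacobi identity, J is read as a bilinear form.
    With A = DF^-1 = N^T at the position of a particle, a^T J b is a sum over
    the particles of expressions in the vectors A a_v, A b_v, the matrix B~ and
    the spline fields Lambda^1 M_1^-1 a_e, Lambda^1 M_1^-1 b_e, plus a constant
    ([poisson_form]).  Contracting a derivative of J with a column of J gives a
    derivative along J c, so the Jacobi identity says that the derivatives of
    a^T J b along J c, of b^T J c along J a and of c^T J a along J b add up to
    zero.  They do so for each particle ([particle_jacobi]), for three reasons.
    The terms with a derivative of A cancel because (D_(A x) A) y is symmetric
    in x and y: this is the symmetry of the second derivatives of F, proved in
    [derive_comm] and [derive_invDF_sym].  The derivatives of B~ with respect to
    the position add up to div B, which is zero as D b = 0.  The derivatives of
    Lambda^1 form a curl, equal to Lambda^2 C, and compensate the derivative of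
    B~ with respect to b, since the b-component of J c is - C M_1^-1 c_e.

    The identities for curl and divergence hold where the spline fields are
    differentiable.  At a particle with q <> 0 this follows from the
    differentiability of the entries of J, because N and M_1 are invertible; at
    a particle with q = 0 all terms with splines carry the factor q. *)

Set Implicit Arguments.
Unset Strict Implicit.
Unset Printing Implicit Defensive.

Local Open Scope classical_set_scope.
Local Open Scope ring_scope.

(** * B-splines on one knot cell *)

Section BsplineCell.
Context {R : realType} (t : nat -> R).
Hypothesis t_nd : {homo t : i j / (i <= j)%N >-> i <= j}.

Section OneCell.
Context (m : nat) (x : R).
Hypothesis x_cell : t m <= x < t m.+1.
Hypothesis x_lt1 : x < 1.

Lemma bspline0_cell i : bspline t 0 i x = (i == m)%:R.
Proof.
rewrite /= (lt_eqF x_lt1) orbF.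
case: (ltngtP i m) => [im|mi|->]; last by rewrite x_cell.
- suff -> : (x < t i.+1) = false by rewrite andbF.
  apply/negbTE; rewrite -leNgt.
  by have [+ _] := andP x_cell; apply: le_trans; apply: t_nd.
- suff -> : (t i <= x) = false by [].
  apply/negbTE; rewrite -ltNge.
  by have [_ +] := andP x_cell; move/lt_le_trans; apply; apply: t_nd.
Qed.

Lemma bspline_off_cell d i : ~~ (i <= m <= i + d)%N -> bspline t d i x = 0.
Proof.
elim: d i => [|d IH] i.
  by rewrite bspline0_cell addn0 -eqn_leq => /negbTE ->.
move=> im; rewrite /= IH ?mulr0 ?add0r; last by apply: contra im; lia.
by rewrite IH ?mulr0 //; apply: contra im; lia.
Qed.

(** The product runs over the d knots in the interior of the support of the
    i-th spline of degree d. *)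
Definition marsden_coef (d i : nat) (tau : R) : R :=
  \prod_(k < d) (t (i + k).+1 - tau).

(** When the recursion is applied to the splines of degree d + 1, each spline of
    degree d receives two terms; their coefficients interpolate linearly between
    the two ends of its support and add up to the factor x - tau. *)
Lemma marsden_identity d tau : (d <= m)%N ->
  \sum_(i < m.+1) marsden_coef d i tau * bspline t d i x = (x - tau) ^+ d.
Proof.
elim: d => [_|d IH dm].
  rewrite (bigD1 ord_max) //= big1 ?addr0 => [|i im].
    by rewrite /marsden_coef big_ord0 mul1r -/(bspline t 0 m x) bspline0_cell eqxx.
  rewrite -/(bspline t 0 i x) bspline0_cell.
  by move: im; rewrite -val_eqE /= => /negbTE ->; rewrite mulr0.
pose al i := (x - t i) / (t (i + d.+1)%N - t i).
pose be i := (t (i + d.+1).+1 - x) / (t (i + d.+1).+1 - t i.+1).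
transitivity (\sum_(i < m.+1) (marsden_coef d.+1 i tau * al i * bspline t d i x) +
  \sum_(i < m.+1) (marsden_coef d.+1 i tau * be i * bspline t d i.+1 x)).
  by rewrite -big_split; apply: eq_bigr => i _ /=; rewrite mulrDr !mulrA.
have off0 : bspline t d 0 x = 0 by apply: bspline_off_cell; lia.
rewrite big_ord_recl big_ord_recr /= off0.
rewrite mulr0 add0r [bspline t d m.+1 x]bspline_off_cell ?mulr0 ?addr0; last by lia.
rewrite -big_split exprS -IH /=; last by lia.
rewrite [in RHS]big_ord_recl mulrDr /= off0.
rewrite !mulr0 add0r mulr_sumr; apply: eq_bigr => i _.
rewrite /bump leq0n add1n.
case: (boolP (i.+1 <= m <= i.+1 + d)%N) => [|im]; last first.
  by rewrite bspline_off_cell // !mulr0 addr0.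
move=> /andP[im mi].
have tt : t i.+1 < t (i + d.+1).+1.
  apply: (@le_lt_trans _ _ (t m)); first exact: t_nd.
  apply: (@lt_le_trans _ _ (t m.+1)).
    by have /andP[] := x_cell; exact: le_lt_trans.
  by apply: t_nd; lia.
rewrite -mulrDl mulrA; congr (_ * _).
have -> : marsden_coef d.+1 i.+1 tau =
    marsden_coef d i.+1 tau * (t (i + d.+1).+1 - tau).
  by rewrite /marsden_coef big_ord_recr /= addSn addnS.
have -> : marsden_coef d.+1 i tau = (t i.+1 - tau) * marsden_coef d i.+1 tau.
  rewrite /marsden_coef big_ord_recl /= addn0; congr (_ * _).
  by apply: eq_bigr => k _; rewrite /bump leq0n addSn !addnS.
rewrite /al /be !addSn.
have tt0 : t (i + d.+1).+1 - t i.+1 != 0 by rewrite subr_eq0 gt_eqF.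
by field.
Qed.

End OneCell.

(** The binomial theorem factors this matrix into two Vandermonde matrices and
    a diagonal matrix of binomial coefficients. *)
Lemma binomial_kernel_unit d (x tau : 'rV[R]_d.+1) :
  injective (x 0) -> injective (tau 0) ->
  (\matrix_(s, r) (x 0 s - tau 0 r) ^+ d : 'M[R]_d.+1) \in unitmx.
Proof.
move=> xI tauI.
have vand (y : 'rV[R]_d.+1) : injective (y 0) -> Vandermonde d.+1 y \in unitmx.
  move=> yI; rewrite unitmxE det_Vandermonde unitfE.
  apply/prodf_neq0 => i _; apply/prodf_neq0 => j ij.
  rewrite subr_eq0; apply: contraTneq ij => /yI ->; by rewrite ltnn.
have -> : (\matrix_(s, r) (x 0 s - tau 0 r) ^+ d : 'M[R]_d.+1) =
   (row_perm (perm rev_ord_inj) (Vandermonde d.+1 x))^T *m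
   diag_mx (\row_k 'C(d, k)%:R) *m Vandermonde d.+1 (- tau).
  apply/matrixP => s r; rewrite mxE exprDn mxE; apply: eq_bigr => k _.
  rewrite -mulr_natr mul_mx_diag !mxE permE /= subSS; ring.
rewrite !unitmx_mul unitmx_tr row_permE unitmx_mul unitmx_perm !vand //; last first.
  by move=> i j; rewrite !mxE => /oppr_inj/tauI.
rewrite unitmxE det_diag unitfE /= andbT; apply/prodf_neq0 => i _.
by rewrite mxE pnatr_eq0 -lt0n bin_gt0 -ltnS.
Qed.

(** Exactly d + 1 splines are nonzero on a cell.  By Marsden's identity the
    matrix of their values at d + 1 points of the cell is a factor of an
    invertible matrix; a row of its inverse is a functional dual to the j-th
    spline. *)
Lemma bspline_dual d m j : (j <= m <= j + d)%N -> (d <= m)%N ->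
  t m < t m.+1 -> t m.+1 <= 1 ->
  exists (x a : 'I_d.+1 -> R), (forall s, t m <= x s < t m.+1) /\
    forall i, \sum_s a s * bspline t d i (x s) = (i == j)%:R.
Proof.
move=> jm dm tm t1.
(* d + 1 distinct points of the cell; the parameters tau are 0, ..., d. *)
pose x (s : 'I_d.+1) : R := t m + (t m.+1 - t m) * (s%:R / d.+1%:R).
have x_cell s : t m <= x s < t m.+1.
  have s0 : 0 <= (s%:R / d.+1%:R : R) by rewrite divr_ge0.
  have s1 : (s%:R / d.+1%:R : R) < 1.
    by rewrite ltr_pdivrMr ?ltr0n // mul1r ltr_nat.
  have tm0 : 0 < t m.+1 - t m by rewrite subr_gt0.
  rewrite /x lerDl mulr_ge0 ?(ltW tm0) //=.
  by rewrite -ltrBrDl gtr_pMr.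
have x_lt1 s : x s < 1 by have /andP[_ /lt_le_trans ->] := x_cell s.
pose B : 'M[R]_d.+1 := \matrix_(s, i) bspline t d (m - d + i) (x s).
pose P : 'M[R]_d.+1 := \matrix_(i, r) marsden_coef d (m - d + i) r%:R.
have BP : B *m P = \matrix_(s, r)
    ((\row_s x s) 0 s - (\row_(r < d.+1) r%:R) 0 r) ^+ d.
  apply/matrixP => s r; rewrite !mxE -(marsden_identity (x_cell s) (x_lt1 s) _ dm).
  rewrite -(big_mkord xpredT (fun i => marsden_coef d i r%:R * bspline t d i (x s))).
  rewrite (@big_cat_nat _ _ _ (m - d)%N) //=; last by lia.
  rewrite [X in _ = X + _]big_nat [X in _ = X + _]big1 ?add0r => [|i im]; last first.
    by rewrite (bspline_off_cell (x_cell s) (x_lt1 s)) ?mulr0 //; lia.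
  rewrite -{1}[(m - d)%N]add0n big_addn big_mkord.
  have -> : (m.+1 - (m - d))%N = d.+1 by lia.
  by apply: eq_bigr => i _; rewrite !mxE mulrC addnC.
have Bu : B \in unitmx.
  suff : B *m P \in unitmx by rewrite unitmx_mul => /andP[].
  rewrite BP; apply: binomial_kernel_unit => i k; rewrite !mxE.
    move/addrI/mulfI; rewrite subr_eq0 (gt_eqF tm) => /(_ isT).
    move/divIf; rewrite pnatr_eq0 => /(_ isT) /eqP.
    by rewrite eqr_nat => /eqP/val_inj.
  by move/eqP; rewrite eqr_nat => /eqP/val_inj.
have jd : (j - (m - d) < d.+1)%N by lia.
exists x, (fun s => invmx B (Ordinal jd) s); split => // i.
case: (boolP (i <= m <= i + d)%N) => im; last first.
  rewrite big1 => [|s _]; last by rewrite (bspline_off_cell (x_cell s)) ?mulr0.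
  by have -> : (i == j) = false by apply: contraNF im => /eqP ->.
have id : (i - (m - d) < d.+1)%N by lia.
have /matrixP/(_ (Ordinal jd) (Ordinal id)) := mulVmx Bu.
rewrite !mxE -val_eqE /=.
have -> : (j - (m - d) == i - (m - d))%N = (i == j) by lia.
move=> <-; apply: eq_bigr => s _; rewrite [in RHS]mxE /=.
by congr (_ * bspline _ _ _ _); lia.
Qed.

End BsplineCell.

(** * Univariate splines: boundedness, right-continuity, dual functionals *)

Section Tame.
Context {R : realType} {d : measure_display} {T : measurableType d}.
(** The integrands are products of splines, which jump at the knots when their
    degree is 0, and of continuous coefficients: this class contains both and is
    stable under sums and products. *)
Definition tame (D : set T) (f : T -> R) : Prop :=
  measurable_fun D f /\ exists M : R, forall x, D x -> `|f x| <= M.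

Lemma tame_cst D c : tame D (fun=> c).
Proof. by split; [exact: measurable_cst|exists `|c|]. Qed.

Lemma tameD D f g : tame D f -> tame D g -> tame D (fun x => f x + g x).
Proof.
move=> [mf [M bf]] [mg [N bg]]; split; first exact: measurable_funD.
exists (M + N) => x Dx; apply: (le_trans (ler_normD _ _)).
by rewrite lerD ?bf ?bg.
Qed.

Lemma tameM D f g : tame D f -> tame D g -> tame D (fun x => f x * g x).
Proof.
move=> [mf [M bf]] [mg [N bg]]; split; first exact: measurable_funM.
by exists (M * N) => x Dx; rewrite normrM ler_pM ?bf ?bg.
Qed.

Lemma tame_sum D (I : Type) (s : seq I) (P : pred I) (f : I -> T -> R) :
  (forall i, tame D (f i)) -> tame D (fun x => \sum_(i <- s | P i) f i x).
Proof.
move=> tf; elim: s => [|i s IH].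
  rewrite (_ : (fun x => _) = fun=> 0); first exact: tame_cst.
  by apply/funext => x; rewrite big_nil.
rewrite (_ : (fun x => _) = if P i then
    (fun x => f i x + \sum_(j <- s | P j) f j x) else
    (fun x => \sum_(j <- s | P j) f j x)); last first.
  by apply/funext => x; rewrite big_cons; case: ifP.
by case: ifP => // _; exact: tameD.
Qed.

Lemma tame_prod D (I : Type) (s : seq I) (f : I -> T -> R) :
  (forall i, tame D (f i)) -> tame D (fun x => \prod_(i <- s) f i x).
Proof.
move=> tf; elim: s => [|i s IH].
  rewrite (_ : (fun x => _) = fun=> 1); first exact: tame_cst.
  by apply/funext => x; rewrite big_nil.
rewrite (_ : (fun x => _) = (fun x => f i x * \prod_(j <- s) f j x)).
  exact: tameM.
by apply/funext => x; rewrite big_cons.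
Qed.

Lemma tame_eq D f g : {in D, f =1 g} -> tame D f -> tame D g.
Proof.
move=> fg [mf [M bf]]; split; first exact: (eq_measurable_fun f).
by exists M => x Dx; rewrite -fg ?bf ?inE.
Qed.

End Tame.

Section Univariate.
Context {R : realType}.

Lemma tame_bspline (t : nat -> R) d i : tame (T := R) `[0, 1] (bspline t d i).
Proof.
have tX : tame (T := R) `[0, 1] (@id R).
  split; first exact: measurable_id.
  by exists 1 => x /=; rewrite in_itv /= => /andP[x0 x1]; rewrite ger0_norm.
elim: d i => [|d IH] i; last first.
  rewrite /=; apply: tameD; apply: tameM => //; apply: tameM;
    try exact: tame_cst.
    by apply: tameD => //; exact: tame_cst.
  apply: tameD; first exact: tame_cst.
  apply: (tame_eq (f := fun x : R => -1 * x)); first by move=> x _; rewrite mulN1r.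
  by apply: tameM => //; exact: tame_cst.
split; last by exists 1 => x _ /=; case: (_ || _); rewrite ?normr1 ?normr0.
apply: measurable_funTS.
pose B : set R := `[t i, t i.+1[%classic `|`
   (if (t i < 1) && (t i.+1 == 1) then [set 1] else set0).
rewrite (_ : bspline t 0 i = \1_B); last first.
  apply/funext => x; rewrite indicE /=; congr (nat_of_bool _)%:R.
  apply/idP/idP; rewrite /B; last first.
    rewrite in_setU => /orP[|]; rewrite inE /=; first by rewrite in_itv /= => ->.
    by case: ifP => [_|_ []] ->; rewrite eqxx orbT.
  case/orP => [H|/andP[/eqP -> H]]; rewrite in_setU; apply/orP.
    by left; rewrite inE /= in_itv.
  by right; rewrite H inE.
apply/measurable_indic/measurableU; first exact: measurable_itv.
by case: ifP.
Qed.

Definition right_cts (f : R -> R) (a : R) : Prop :=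
  f @ within [set x | a <= x] (nbhs a) --> f a.

(** Right-continuity fails at 1 in degree 0, where the last cell is closed. *)
Lemma right_cts_bspline (t : nat -> R) d i a : a < 1 ->
  right_cts (bspline t d i) a.
Proof.
move=> a1; elim: d i => [|d IH] i; last first.
  have cX : right_cts id a by apply: cvg_within_filter; exact: cvg_id.
  have cc (c : R) : right_cts (fun=> c) a by apply: cvg_cst.
  pose al x := (x - t i) / (t (i + d.+1)%N - t i).
  pose be x := (t (i + d.+1).+1 - x) / (t (i + d.+1).+1 - t i.+1).
  have cal : right_cts al a by exact: (cvgM (cvgB cX (cc _)) (cc _)).
  have cbe : right_cts be a by exact: (cvgM (cvgB (cc _) cX) (cc _)).
  exact: (cvgD (cvgM cal (IH i)) (cvgM cbe (IH i.+1))).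
apply: cvg_near_cst.
suff : \forall x \near nbhs a, a <= x -> bspline t 0 i x = bspline t 0 i a by [].
have near_lt (c : R) : a < c -> \forall x \near nbhs a, x < c.
  by move=> ac; exact: lt_nbhsl.
have x1 := near_lt _ a1.
have [ti|/near_lt ti] := leP (t i) a; last first.
  near=> x => ax; congr (nat_of_bool _)%:R.
  rewrite !(lt_eqF (near x1 x _)) ?(lt_eqF a1) ?orbF //.
  by rewrite leNgt (near ti x _) //= leNgt; move: (nbhs_singleton ti) => ->.
have [/near_lt ati|ati] := ltP a (t i.+1).
  near=> x => ax; congr (nat_of_bool _)%:R.
  rewrite (near ati x _) ?(nbhs_singleton ati) //.
  by rewrite (le_trans ti ax) ti.
near=> x => ax; congr (nat_of_bool _)%:R.
rewrite !(lt_eqF (near x1 x _)) ?(lt_eqF a1) ?orbF //.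
by rewrite !(ltNge _ (t i.+1)) (le_trans ati ax) ati !andbF.
Unshelve. all: by end_near. Qed.

Lemma periodic_bsplineE n d j (x : R) : 0 <= x < 1 ->
  periodic_bspline n d j x = \sum_(i < n + d | (i == j %[mod n])%N)
    bspline (uniform_knot n d) d i x.
Proof.
move=> x01; apply: eq_bigr => i _; suff -> : Num.floor x = 0 by rewrite subr0.
by apply: floor_def; rewrite add0r.
Qed.

Lemma tame_spline n p dir low i : tame (T := R) `[0, 1] (@spline R n p dir low i).
Proof.
rewrite /spline; case: (dir == ord0).
  by case: low; rewrite /clamped_bspline; exact: tame_bspline.
set d := if low then _ else _.
have tI : tame (T := R) `[0, 1] (fun x : R => \sum_(k < n + d | (k == i %[mod n])%N)
   bspline (uniform_knot n d) d k x) by apply: tame_sum => k; exact: tame_bspline.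
split.
  apply/(measurable_fun_itv_bndo_bndcP (BLeft 0)).
  apply: (eq_measurable_fun (fun x : R => \sum_(k < n + d | (k == i %[mod n])%N)
    bspline (uniform_knot n d) d k x)).
    by move=> x; rewrite inE /= in_itv /= => x01; rewrite periodic_bsplineE.
  by apply: measurable_funS tI.1 => //; move=> x; exact: subset_itv_co_cc.
have [M bM] := tI.2; exists M => x _.
rewrite /periodic_bspline; apply: (bM (x - (Num.floor x)%:~R)).
by rewrite /= in_itv /= subr_ge0 ge_floor lerBlDl ltW // -intrD1 lt_succ_floor.
Qed.

Lemma right_cts_spline n p dir low i (a : R) : 0 <= a < 1 ->
  right_cts (spline n p dir low i) a.
Proof.
move=> a01; have /andP[a0 a1] := a01.
rewrite /spline; case: (dir == ord0).
  by case: low; rewrite /clamped_bspline; exact: right_cts_bspline.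
set d := if low then _ else _.
rewrite /right_cts periodic_bsplineE //.
apply: (@cvg_trans _ ((fun x : R => \sum_(k < n + d | (k == i %[mod n])%N)
   bspline (uniform_knot n d) d k x) @ within [set x | a <= x] (nbhs a))).
  apply: near_eq_cvg.
  suff : \forall x \near nbhs a, a <= x -> \sum_(k < n + d | (k == i %[mod n])%N)
      bspline (uniform_knot n d) d k x = periodic_bspline n d i x by [].
  near=> x => ax.
  rewrite periodic_bsplineE // (le_trans a0 ax) /=.
  by near: x; exact: lt_nbhsl.
apply: cvg_big => [|k _]; first exact: add_continuous.
exact: right_cts_bspline.
Unshelve. all: by end_near. Qed.

Lemma uniform_knot_nd n d : {homo @uniform_knot R n d : i j / (i <= j)%N >-> i <= j}.
Proof.
by move=> i j ij; rewrite ler_wpM2r ?invr_ge0 // lerB // ler_nat.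
Qed.

Lemma uniform_knot_lt n d m : (0 < n)%N -> uniform_knot n d m < uniform_knot n d m.+1
  :> R.
Proof. by move=> n0; rewrite ltr_pM2r ?invr_gt0 ?ltr0n // ltrD2r ltr_nat. Qed.

Lemma uniform_knot_ge0 n d m : (d <= m)%N -> 0 <= uniform_knot n d m :> R.
Proof. by move=> dm; rewrite mulr_ge0 ?invr_ge0 // subr_ge0 ler_nat. Qed.

Lemma uniform_knot_le1 n d m : (0 < n)%N -> (m <= n + d)%N ->
  uniform_knot n d m <= 1 :> R.
Proof.
move=> n0 mn; rewrite ler_pdivrMr ?ltr0n // mul1r lerBlDr -natrD ler_nat //.
Qed.

(** A functional dual to f j, made of evaluations at points of [0,1).  For all
    j < N together this is the linear independence of f 0, ..., f N.-1, in a form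
    that is stable under tensor products. *)
Definition dual_nodes (f : nat -> R -> R) (N j : nat) : Prop :=
  exists K (x a : 'I_K -> R), (forall s, 0 <= x s < 1) /\
    forall i, (i < N)%N -> \sum_s a s * f i (x s) = (i == j)%:R.

Lemma clamped_dual n d j : (0 < n)%N -> (j < n + d)%N ->
  dual_nodes (clamped_bspline n d) (n + d) j.
Proof.
move=> n0 jn; pose m := maxn j d.
have t_nd : {homo (fun k => Num.min 1 (Num.max 0 (uniform_knot n d k) : R)) :
    i k / (i <= k)%N >-> i <= k}.
  by move=> i k ik; rewrite le_min2 // le_max2 // uniform_knot_nd.
have tE k : (d <= k <= n + d)%N ->
    Num.min 1 (Num.max 0 (uniform_knot n d k)) = uniform_knot n d k :> R.
  move=> /andP[dk kn]; rewrite (max_idPr _) ?uniform_knot_ge0 //.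
  by rewrite (min_idPr _) ?uniform_knot_le1.
have := @bspline_dual _ _ t_nd d m j.
rewrite !tE; [|lia|lia].
case; [lia|lia|exact: uniform_knot_lt|by apply: uniform_knot_le1; lia|].
move=> x [a [xm xa]]; exists d.+1, x, a; split => [s|i _]; last exact: xa.
have /andP[x0 x1] := xm s.
rewrite (le_trans _ x0) ?uniform_knot_ge0 //=; last by lia.
by rewrite (lt_le_trans x1) // uniform_knot_le1 //; lia.
Qed.

(** The i-th periodic spline is a sum of B-splines whose indices are congruent to
    i modulo n, and at most one of them has index j. *)
Lemma periodic_dual n d j : (0 < n)%N -> (j < n)%N ->
  dual_nodes (periodic_bspline n d) n j.
Proof.
move=> n0 jn; pose m := maxn j d.
have := @bspline_dual _ _ (@uniform_knot_nd n d) d m j.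
case; [lia|lia|exact: uniform_knot_lt|by apply: uniform_knot_le1; lia|].
move=> x [a [xm xa]]; exists d.+1, x, a.
have x01 s : 0 <= x s < 1.
  have /andP[x0 x1] := xm s.
  rewrite (le_trans _ x0) ?uniform_knot_ge0 //=; last by lia.
  by rewrite (lt_le_trans x1) // uniform_knot_le1 //; lia.
split => // i iN.
under eq_bigr do rewrite periodic_bsplineE // mulr_sumr.
rewrite exchange_big /=; under eq_bigr do rewrite xa.
have jnd : (j < n + d)%N by lia.
case: eqP => [ij|nij]; last first.
  rewrite big1 // => k; rewrite (modn_small iN) => kij.
  by have -> // : (k == j :> nat) = false; apply/negbTE/eqP => kj; apply: nij;
    move: kij; rewrite kj modn_small // => /eqP.
rewrite (bigD1 (Ordinal jnd)) /= ?ij ?eqxx //.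
by rewrite big1 ?addr0 // => k /andP[_]; rewrite -val_eqE /= => /negbTE ->.
Qed.

Lemma spline_dual n p dir low j : (0 < n)%N -> (0 < p)%N ->
  (j < spline_count n p dir low)%N ->
  dual_nodes (spline n p dir low) (spline_count n p dir low) j.
Proof.
rewrite /spline_count /spline => n0 p0.
case: ifP => _; last by move=> jn; exact: periodic_dual.
case: ifP => _ jn.
  have [|K [x [a [x01 xa]]]] := @clamped_dual n p.-1 j n0; first by lia.
  by exists K, x, a; split => // i iN; apply: xa; lia.
have [|K [x [a [x01 xa]]]] := @clamped_dual n p j.+1 n0; first by lia.
by exists K, x, a; split => // i iN; rewrite xa; [|lia].
Qed.

End Univariate.

(** * Differentiability of matrix-valued maps, symmetry of second derivatives *)

Section Differentiability.
Context {R : realType} {V : normedModType R}.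

Lemma near0_differentiable (W : normedModType R) (f : V -> W) x :
  (\near x, f x = 0) -> differentiable f x.
Proof.
move=> f0.
have fx0 : f x = 0 := nbhs_singleton f0.
have f0' : \forall y \near (0 : V), f (y + x) = 0.
  by move: f0; rewrite (near_shift 0) subr0.
pose L : {linear V -> W} := \0.
have Lc : continuous L by move=> y; apply: cvg_cst.
have fo : f \o shift x = cst (f x) + L +o_ 0 id.
  apply/eqaddoP => _/posnumP[e]; near=> y.
  rewrite !fctE /= fx0 addr0 subr0 (near f0' y) //.
  by rewrite normr0 mulr_ge0.
apply/diff_locallyP; rewrite (diff_unique Lc fo); split => //.
Unshelve. all: by end_near. Qed.

Lemma near_eq_differentiable (W : normedModType R) (f g : V -> W) x :
  (\near x, f x = g x) -> differentiable f x -> differentiable g x.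
Proof.
move=> fg df; rewrite (_ : g = f + (g - f)); last by rewrite addrC subrK.
apply: differentiableD => //; apply: near0_differentiable.
by near=> y; rewrite -[LHS]/(g y - f y) (near fg y) ?subrr.
Unshelve. all: by end_near. Qed.

Lemma differentiable_bigsum (I : Type) (s : seq I) (P : pred I)
    (f : I -> V -> R) x :
  (forall i, P i -> differentiable (f i) x) ->
  differentiable (fun y => \sum_(i <- s | P i) f i y) x.
Proof.
move=> df; elim: s => [|i s IH].
  rewrite (_ : (fun y => _) = cst 0); first exact: differentiable_cst.
  by apply/funext => y; rewrite big_nil.
have [Pi|Pi] := boolP (P i).
  rewrite (_ : (fun y => _) = f i + (fun y => \sum_(i <- s | P i) f i y)).
    exact: (differentiableD (df _ Pi) IH).
  by apply/funext => y; rewrite big_cons Pi.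
rewrite (_ : (fun y => _) = (fun y => \sum_(i <- s | P i) f i y)) //.
by apply/funext => y; rewrite big_cons (negbTE Pi).
Qed.

Lemma differentiable_mulr (f g : V -> R) x :
  differentiable f x -> differentiable g x -> differentiable (fun y => f y * g y) x.
Proof. by move=> df dg; exact: (differentiableM df dg). Qed.

Lemma differentiable_bigprod (I : Type) (s : seq I) (f : I -> V -> R) x :
  (forall i, differentiable (f i) x) ->
  differentiable (fun y => \prod_(i <- s) f i y) x.
Proof.
move=> df; elim: s => [|i s IH].
  rewrite (_ : (fun y => _) = cst 1); first exact: differentiable_cst.
  by apply/funext => y; rewrite big_nil.
rewrite (_ : (fun y => _) = fun y => f i y * \prod_(i <- s) f i y).
  by apply: differentiable_mulr; [exact: df|].
by apply/funext => y; rewrite big_cons.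
Qed.

Definition mx_differentiable m n (A : V -> 'M[R]_(m, n)) (x : V) : Prop :=
  forall i j, differentiable (fun y => A y i j) x.

Lemma differentiable_mulmx m n k (A : V -> 'M[R]_(m, n)) (B : V -> 'M[R]_(n, k)) x :
  mx_differentiable A x -> mx_differentiable B x ->
  mx_differentiable (fun y => A y *m B y) x.
Proof.
move=> dA dB i j.
rewrite (_ : (fun y => _) = fun y => \sum_k A y i k * B y k j).
  by apply: differentiable_bigsum => l _; exact: differentiable_mulr.
by apply/funext => y; rewrite mxE.
Qed.

Lemma differentiable_trmx m n (A : V -> 'M[R]_(m, n)) x :
  mx_differentiable A x -> mx_differentiable (fun y => (A y)^T) x.
Proof.
move=> dA i j; rewrite (_ : (fun y => _) = fun y => A y j i) //.
by apply/funext => y; rewrite mxE.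
Qed.

Lemma differentiable_scalemx m n (c : V -> R) (A : V -> 'M[R]_(m, n)) x :
  differentiable c x -> mx_differentiable A x ->
  mx_differentiable (fun y => c y *: A y) x.
Proof.
move=> dc dA i j; rewrite (_ : (fun y => _) = fun y => c y * A y i j).
  exact: differentiable_mulr.
by apply/funext => y; rewrite mxE.
Qed.

Lemma differentiable_det n (A : V -> 'M[R]_n) x :
  mx_differentiable A x -> differentiable (fun y => \det (A y)) x.
Proof.
move=> dA; apply: differentiable_bigsum => s _; apply: differentiable_mulr => //.
by apply: differentiable_bigprod => i; exact: dA.
Qed.

Lemma differentiable_adj n (A : V -> 'M[R]_n) x :
  mx_differentiable A x -> mx_differentiable (fun y => \adj (A y)) x.
Proof.
move=> dA i j; rewrite (_ : (fun y => _) =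
  (fun y => (-1) ^+ (j + i) * \det (row' j (col' i (A y))))); last first.
  by apply/funext => y; rewrite mxE.
apply: differentiable_mulr => //; apply: differentiable_det => k l.
rewrite (_ : (fun y => _) = fun y => A y (lift j k) (lift i l)) //.
by apply/funext => y; rewrite !mxE.
Qed.

Lemma near_unitmx n (A : V -> 'M[R]_n) x :
  mx_differentiable A x -> A x \in unitmx -> \near x, A x \in unitmx.
Proof.
move=> dA; rewrite unitmxE unitfE => Ax.
have H := differentiable_continuous (differentiable_det dA).
have := cvgr_neq0 _ H Ax.
move=> /(_ _) nA; near=> y; rewrite unitmxE unitfE; near: y; exact: nA.
Unshelve. all: by end_near.
Qed.

Lemma differentiable_invmx n (A : V -> 'M[R]_n) x :
  mx_differentiable A x -> A x \in unitmx ->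
  mx_differentiable (fun y => invmx (A y)) x.
Proof.
move=> dA uA i j.
have dB : mx_differentiable (fun y => (\det (A y))^-1 *: \adj (A y)) x.
  apply: differentiable_scalemx; last exact: differentiable_adj.
  apply: (differentiableV (differentiable_det dA)).
  by rewrite -unitfE -unitmxE.
apply: near_eq_differentiable (dB i j).
have nA := near_unitmx dA uA.
by near=> y; rewrite /invmx (near nA y).
Unshelve. all: by end_near. Qed.

End Differentiability.

Section Young.
Context {R : realType}.

Lemma derive_line_eq (V V' W : normedModType R) (f : V -> W) (g : V' -> W) x y v w :
  (forall h : R, f (h *: v + x) = g (h *: w + y)) ->
  'D_v f x = 'D_w g y /\ (derivable g y w -> derivable f x v).
Proof.
move=> fg; have fg0 : f x = g y by have := fg 0; rewrite !scale0r !add0r.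
rewrite /derive /derivable.
suff -> : (fun h : R => h^-1 *: ((f \o shift x) (h *: v) - f x)) =
  (fun h : R => h^-1 *: ((g \o shift y) (h *: w) - g y)) by [].
by apply/funext => h /=; rewrite fg fg0.
Qed.

Context {V : normedModType R}.

Lemma mvt_line (f : V -> R) (z v : V) (h : R) : 0 < h ->
  (forall t, 0 <= t <= h -> differentiable f (t *: v + z)) ->
  exists2 c, 0 < c < h & f (h *: v + z) - f z = h * 'D_v f (c *: v + z).
Proof.
move=> h0 df.
pose g (t : R) := f (t *: v + z).
have dg t : 0 <= t <= h -> is_derive t 1 g ('D_v f (t *: v + z)).
  move=> th; have HL k : (k *: (1 : R) + t) *: v + z = k *: v + (t *: v + z).
    by rewrite scalerDl addrA [_ *: 1]mulr1.
  have [E D] := @derive_line_eq R^o V _ g f t (t *: v + z) 1 v (fun k =>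
    congr1 f (HL k)).
  apply: DeriveDef; first by apply: D; apply: diff_derivable; exact: df.
  exact: E.
have gc : {within `[0, h], continuous g}.
  apply: derivable_within_continuous => t; rewrite in_itv /= => th.
  by case: (dg t th).
have dgo t : t \in `]0, h[ -> is_derive t 1 g ('D_v f (t *: v + z)).
  by rewrite in_itv /= => /andP[t0 th]; apply: dg; rewrite !ltW.
have [c ch E] := MVT h0 dgo gc.
exists c => //; move: E; rewrite /g scale0r add0r subr0 => ->; exact: mulrC.
Qed.

(** The mean value theorem, once in each of the two directions. *)
Lemma second_difference (f : V -> R) (U : set V) (x v w : V) :
  open U -> U x -> (forall y, U y -> differentiable f y) ->
  (forall y, U y -> differentiable ('D_v f) y) ->
  \forall h \near 0^'+, exists c c' : R, [/\ 0 < c < h, 0 < c' < h &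
    f (h *: v + (h *: w + x)) - f (h *: v + x) - (f (h *: w + x) - f x)
    = h ^+ 2 * 'D_w ('D_v f) (c' *: w + (c *: v + x))].
Proof.
move=> oU Ux df ddf.
have [r /= r0 rU] : nbhs_ball x U by apply/nbhs_ballP; exact: open_nbhs_nbhs.
pose M := `|v| + `|w| + 1.
have M0 : 0 < M by rewrite ltr_wpDl // addr_ge0.
near=> h.
have h0 : 0 < h by [].
have hr : h * M < r.
  rewrite -ltr_pdivlMr //; near: h; apply: nbhs_right_lt.
  by rewrite divr_gt0.
have inU s t : 0 <= s <= h -> 0 <= t <= h -> U (s *: v + (t *: w + x)).
  move=> /andP[s0 sh] /andP[t0 th]; apply: rU; rewrite -ball_normE /=.
  rewrite addrA opprD addrCA subrr addr0 normrN.
  apply: le_lt_trans hr; apply: (le_trans (ler_normD _ _)).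
  rewrite !normrZ (ger0_norm s0) (ger0_norm t0).
  apply: (@le_trans _ _ (h * `|v| + h * `|w|)); first by rewrite lerD // ler_wpM2r.
  by rewrite -mulrDr ler_wpM2l ?(ltW h0) // lerDl.
pose g y := f (y + h *: w) - f y.
have dfw y : U (y + h *: w) -> differentiable (fun y => f (y + h *: w)) y.
  by move=> Uy; apply: (@differentiable_comp _ _ _ _ (fun y => y + h *: w)) => //;
    exact: df.
have dg t : 0 <= t <= h -> differentiable g (t *: v + x).
  move=> th; apply: differentiableB.
    by apply: dfw; rewrite -addrA [x + _]addrC; apply: inU; rewrite // lexx ltW.
  apply: df; rewrite -[x]add0r -[X in _ + (X + x)](scale0r w); apply: inU => //.
  by rewrite lexx ltW.
have [c ch E] := mvt_line h0 dg.
have cch : 0 <= c <= h by case/andP: ch => c0 c1; rewrite !ltW.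
have [|c' ch' E'] := @mvt_line ('D_v f) (c *: v + x) w h h0.
  by move=> t th; apply: ddf; rewrite addrCA; exact: inU.
exists c, c'; split => //.
rewrite expr2 -mulrA -E'.
transitivity (g (h *: v + x) - g x).
  by rewrite /g -[h *: v + x + _]addrA ![x + _]addrC.
rewrite E; congr (_ * _).
have Uc : U (c *: v + x).
  by rewrite -[x]add0r -[X in _ + (X + x)](scale0r w); apply: inU; rewrite // lexx ltW.
have Uc' : U (c *: v + x + h *: w).
  by rewrite -addrA [x + _]addrC; apply: inU; rewrite // lexx ltW.
rewrite deriveB; [|exact/diff_derivable/dfw|exact/diff_derivable/df].
congr (_ - _).
have HL k : k *: v + (c *: v + x) + h *: w = k *: v + (c *: v + x + h *: w).
  by rewrite -!addrA.
have [-> _] := @derive_line_eq V V _ (fun y => f (y + h *: w)) f (c *: v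
  + x) _ v v (fun k => congr1 f (HL k)).
by rewrite [_ + h *: w]addrC.
Unshelve. all: by end_near. Qed.

Lemma second_difference_lim (f : V -> R) (U : set V) (x v w : V) :
  open U -> U x -> (forall y, U y -> differentiable f y) ->
  (forall y, U y -> differentiable ('D_v f) y) ->
  {for x, continuous ('D_w ('D_v f))} ->
  h ^- 2 * (f (h *: v + (h *: w + x)) - f (h *: v + x) - (f (h *: w + x) - f x))
    @[h --> 0^'+] --> 'D_w ('D_v f) x.
Proof.
move=> oU Ux df ddf ctsD.
apply/cvgrPdist_lt => e e0.
have [r /= r0 rD] : nbhs_ball x [set y | `|'D_w ('D_v f) x - 'D_w ('D_v f) y| < e].
  by apply/nbhs_ballP; exact: (cvgr_dist_lt _ _ ctsD _ e0).
pose M := `|v| + `|w| + 1.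
have M0 : 0 < M by rewrite ltr_wpDl // addr_ge0.
have nsd := second_difference w oU Ux df ddf.
near=> h.
have h0 : 0 < h by [].
have hr : h * M < r.
  rewrite -ltr_pdivlMr //; near: h; apply: nbhs_right_lt.
  by rewrite divr_gt0.
have [//|c [c' [/andP[c0 ch] /andP[c0' ch'] ->]]] := near nsd h.
rewrite mulKf ?expf_neq0 ?gt_eqF //; apply: rD; rewrite -ball_normE /=.
rewrite addrA opprD addrCA subrr addr0 normrN.
apply: le_lt_trans hr; apply: (le_trans (ler_normD _ _)).
rewrite !normrZ (gtr0_norm c0) (gtr0_norm c0') addrC.
apply: (@le_trans _ _ (h * `|v| + h * `|w|)).
  by rewrite lerD // ler_wpM2r // ltW.
by rewrite -mulrDr ler_wpM2l ?(ltW h0) // lerDl.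
Unshelve. all: by end_near. Qed.

(** The second difference is symmetric in v and w; divided by h^2, it tends to
    both iterated derivatives. *)
Lemma derive_comm (f : V -> R) (U : set V) (x v w : V) :
  open U -> U x -> (forall y, U y -> differentiable f y) ->
  (forall y, U y -> differentiable ('D_v f) y) ->
  (forall y, U y -> differentiable ('D_w f) y) ->
  {for x, continuous ('D_w ('D_v f))} ->
  {for x, continuous ('D_v ('D_w f))} ->
  'D_w ('D_v f) x = 'D_v ('D_w f) x.
Proof.
move=> oU Ux df dv dw cv cw.
pose q a b (h : R) := h ^- 2 *
  (f (h *: a + (h *: b + x)) - f (h *: a + x) - (f (h *: b + x) - f x)).
have qC : q v w = q w v.
  by apply/funext => h; rewrite /q [h *: w + (h *: v + x)]addrCA; ring.
have Lv : q v w h @[h --> 0^'+] --> 'D_w ('D_v f) x :=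
  second_difference_lim oU Ux df dv cv.
have Lw : q w v h @[h --> 0^'+] --> 'D_v ('D_w f) x :=
  second_difference_lim oU Ux df dw cw.
by rewrite -(cvg_lim _ Lv) // -(cvg_lim _ Lw) // qC.
Qed.

End Young.

(** * The coordinate map *)

Section MatrixDerivative.
Context {R : realType} {V : normedModType R}.

Fact derive_mxe_key : unit. Proof. exact: tt. Qed.

(** Entrywise directional derivative.  It is locked so that a comparison of two
    derivatives stops at their arguments and does not unfold them into limits. *)
Definition derive_mxe m n : (V -> 'M[R]_(m, n)) -> V -> V -> 'M[R]_(m, n) :=
  locked_with derive_mxe_key
    (fun A x h => \matrix_(i, j) 'D_h (fun y => A y i j) x).

Lemma derive_mxeP m n (A : V -> 'M[R]_(m, n)) x h i j :
  derive_mxe A x h i j = 'D_h (fun y => A y i j) x.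
Proof. by rewrite /derive_mxe unlock mxE. Qed.

Lemma derive_bigsum (I : finType) (f : I -> V -> R) (x h : V) :
  (forall i, derivable (f i) x h) ->
  derivable (fun y => \sum_i f i y) x h /\
  'D_h (fun y => \sum_i f i y) x = \sum_i 'D_h (f i) x.
Proof.
move=> df; suff : is_derive x h (fun y => \sum_i f i y) (\sum_i 'D_h (f i) x).
  by case.
elim: (index_enum I) => [|i s IH].
  rewrite big_nil (_ : (fun y => _) = cst 0); first exact: is_derive_cst.
  by apply/funext => y; rewrite big_nil.
rewrite big_cons (_ : (fun y => _) = f i + (fun y => \sum_(i <- s) f i y)).
  by apply: is_deriveD; apply: derivableP.
by apply/funext => y; rewrite big_cons.
Qed.

Lemma derive_mulmx m n k (A : V -> 'M[R]_(m, n)) (B : V -> 'M[R]_(n, k)) x h :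
  mx_differentiable A x -> mx_differentiable B x ->
  derive_mxe (fun y => A y *m B y) x h =
  derive_mxe A x h *m B x + A x *m derive_mxe B x h.
Proof.
move=> dA dB; apply/matrixP => i j; rewrite derive_mxeP !mxE -big_split /=.
rewrite (_ : (fun y => _) = fun y => \sum_k A y i k * B y k j); last first.
  by apply/funext => y; rewrite mxE.
have dAd a b : derivable (fun y => A y a b) x h by apply: diff_derivable; exact: dA.
have dBd a b : derivable (fun y => B y a b) x h by apply: diff_derivable; exact: dB.
have [|_ ->] := @derive_bigsum _ (fun k y => A y i k * B y k j) x h.
  by move=> l; apply: (derivableM (dAd _ _) (dBd _ _)).
apply: eq_bigr => l _; rewrite (deriveM (dAd _ _) (dBd _ _)) !derive_mxeP.
by rewrite addrC; congr (_ + _); exact: mulrC.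
Qed.

Lemma near_eq_derive_mxe m n (A B : V -> 'M[R]_(m, n)) x h :
  (\near x, A x = B x) -> derive_mxe A x h = derive_mxe B x h.
Proof.
move=> AB; apply/matrixP => i j; rewrite !derive_mxeP; apply: near_eq_derive.
by near=> y; rewrite (near AB y).
Unshelve. all: by end_near. Qed.

Lemma derive_mxe_cst m n (A : 'M[R]_(m, n)) x h : derive_mxe (fun=> A) x h = 0.
Proof. by apply/matrixP => i j; rewrite derive_mxeP mxE; exact: derive_cst. Qed.

(** Differentiate invmx A *m A = 1. *)
Lemma derive_invmx n (A : V -> 'M[R]_n) x h :
  mx_differentiable A x -> A x \in unitmx ->
  derive_mxe (fun y => invmx (A y)) x h =
  - (invmx (A x) *m derive_mxe A x h *m invmx (A x)).
Proof.
move=> dA uA; have dV := differentiable_invmx dA uA.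
have : derive_mxe (fun y => invmx (A y) *m A y) x h = 0.
  rewrite -(derive_mxe_cst 1%:M x h); apply: near_eq_derive_mxe.
  have nA := near_unitmx dA uA.
  by near=> y; rewrite mulVmx // (near nA y).
rewrite derive_mulmx // => /(congr1 (mulmxr (invmx (A x)))) /=.
by rewrite mul0mx mulmxDl mulmxK // => /eqP; rewrite addr_eq0 => /eqP.
Unshelve. all: by end_near. Qed.

Lemma derive_mxeE m n (A : V -> 'M[R]_(m, n)) x h :
  differentiable A x -> 'D_h A x = derive_mxe A x h.
Proof.
move=> dA; rewrite derive_mx; last exact: diff_derivable.
by apply/matrixP => i j; rewrite mxE derive_mxeP.
Qed.

End MatrixDerivative.

Section CoordinateMap.
Context {R : realType} (F : 'rV[R]_3 -> 'rV[R]_3) (U : set 'rV[R]_3).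
Hypotheses (oU : open U) (sF : smooth_on U F).

Lemma derive_coord (G : 'rV[R]_3 -> 'rV[R]_3) v y i : differentiable G y ->
  'D_v (fun z => G z 0 i) y = 'D_v G y 0 i.
Proof. by move=> dG; rewrite derive_mxeE // derive_mxeP. Qed.

Lemma differentiable_rV_coord (G : 'rV[R]_3 -> 'rV[R]_3) y i :
  differentiable G y -> differentiable (fun z => G z 0 i) y.
Proof.
by move=> dG; apply: (@differentiable_comp _ _ _ _ G (fun M : 'rV[R]_3 => M 0 i)) =>
  //; exact: differentiable_coord.
Qed.

Lemma derive_DF v y : U y -> 'D_v F y = (DF F y *m v^T)^T.
Proof.
by move=> Uy; rewrite trmx_mul !trmxK; apply: deriveEjacobian; exact: (sF [::]).
Qed.

Lemma DF_E y k i : U y -> DF F y k i = 'D_(delta_mx 0 i) F y 0 k.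
Proof. by move=> Uy; rewrite derive_DF // [RHS]mxE trmx_delta -colE [RHS]mxE. Qed.

Lemma nearU y : U y -> \near y, U y.
Proof. by move=> Uy; exact: open_nbhs_nbhs. Qed.

Lemma DF_differentiable y : U y -> mx_differentiable (DF F) y.
Proof.
move=> Uy k i.
apply: (near_eq_differentiable (f := fun y => 'D_(delta_mx 0 i) F y 0 k)).
  by near=> z; rewrite DF_E //; near: z; exact: nearU.
by apply: differentiable_rV_coord; exact: (sF [:: delta_mx 0 i]).
Unshelve. all: by end_near. Qed.

Lemma second_derivative_comm y v w : U y -> 'D_w ('D_v F) y = 'D_v ('D_w F) y.
Proof.
move=> Uy; apply/rowP => k.
pose f z := F z 0 k.
have Df a z : U z -> 'D_a f z = 'D_a F z 0 k.
  by move=> Uz; apply: derive_coord; exact: (sF [::]).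
have nDf a z : U z -> \near z, 'D_a F z 0 k = 'D_a f z.
  by move=> Uz; near=> z'; rewrite Df //; near: z'; exact: nearU.
have dDf a z : U z -> differentiable ('D_a f) z.
  move=> Uz; apply: near_eq_differentiable (nDf a z Uz) _.
  by apply: differentiable_rV_coord; exact: (sF [:: a]).
have DDf a b z : U z -> 'D_b ('D_a f) z = 'D_b ('D_a F) z 0 k.
  move=> Uz; rewrite -(near_eq_derive _ (nDf a z Uz)).
  by apply: derive_coord; exact: (sF [:: a]).
have cDDf a b z : U z -> {for z, continuous ('D_b ('D_a f))}.
  move=> Uz; apply: differentiable_continuous.
  apply: (near_eq_differentiable (f := fun y => 'D_b ('D_a F) y 0 k)).
    by near=> z'; rewrite DDf //; near: z'; exact: nearU.
  by apply: differentiable_rV_coord; exact: (sF [:: b; a]).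
have df z : U z -> differentiable f z.
  by move=> Uz; apply: differentiable_rV_coord; exact: (sF [::]).
have E := derive_comm oU Uy df (dDf v) (dDf w) (cDDf v w y Uy) (cDDf w v y Uy).
exact: (etrans (esym (DDf v w y Uy)) (etrans E (DDf w v y Uy))).
Unshelve. all: by end_near. Qed.

Lemma derive_DF_mx y v w : U y ->
  derive_mxe (DF F) y w *m v^T = ('D_w ('D_v F) y)^T.
Proof.
move=> Uy; have dv : differentiable ('D_v F) y by exact: (sF [:: v]).
rewrite derive_mxeE // (@near_eq_derive_mxe _ _ _ _ _ (fun z => (DF F z *m v^T)^T));
  last first.
  by near=> z; apply: derive_DF; near: z; exact: nearU.
have cv : mx_differentiable (fun=> v^T) y by move=> i j; exact: differentiable_cst.
transitivity (derive_mxe (fun z => DF F z *m v^T) y w).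
  by rewrite derive_mulmx ?derive_mxe_cst ?mulmx0 ?addr0 //; exact: DF_differentiable.
apply/matrixP => i j; rewrite [RHS]mxE !derive_mxeP; congr ('D_w _ y).
by apply/funext => z; rewrite [in RHS]mxE.
Unshelve. all: by end_near. Qed.

(** The left-hand side is - A (D^2 F)(A a, A b), symmetric in a and b.  In
    geometric terms, the columns of A are commuting vector fields. *)
Lemma derive_invDF_sym y (a b : 'cV[R]_3) : U y -> JF F y != 0 ->
  let A := fun z => invmx (DF F z) in
  derive_mxe A y (A y *m a)^T *m b = derive_mxe A y (A y *m b)^T *m a.
Proof.
move=> Uy Jy A.
have uD : DF F y \in unitmx by rewrite unitmxE unitfE.
have E h (c : 'cV[R]_3) :
    derive_mxe A y h *m c = - (A y *m ('D_h ('D_((A y *m c)^T) F) y)^T).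
  rewrite derive_invmx //; last exact: DF_differentiable.
  by rewrite -derive_DF_mx // trmxK mulNmx -!mulmxA.
have C := second_derivative_comm (A y *m b)^T (A y *m a)^T Uy.
apply: (etrans (E _ b)); apply: (etrans _ (esym (E _ a))).
exact: (congr1 (fun M : 'rV[R]_3 => - (A y *m M^T)) C).
Qed.

End CoordinateMap.

(** * Integrable functions on the cube *)

Section Cube.
Context {R : realType}.
Local Notation leb := (@lebesgue_measure R).
Local Notation leb3 := ((leb \x leb) \x leb)%E.

Definition cube3 : set (R * R * R) := (`[0, 1] `*` `[0, 1]) `*` `[0, 1].

Definition coord (d : 'I_3) (x : R * R * R) : R := [:: x.1.1; x.1.2; x.2]`_d.

Lemma point3E x d : point3 x 0 d = coord d x.
Proof. by rewrite mxE. Qed.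

(** The indices are written 0, 1, 1 + 1 because curl and the rotation matrix
    refer to i, i + 1 and i + 2. *)
Lemma ord3 (P : 'I_3 -> Prop) : P 0 -> P 1 -> P (1 + 1) -> forall d, P d.
Proof.
move=> P0 P1 P2 [[|[|[|//]]] hd].
- by rewrite (_ : Ordinal hd = 0) //; apply: val_inj.
- by rewrite (_ : Ordinal hd = 1) //; apply: val_inj.
- by rewrite (_ : Ordinal hd = 1 + 1) //; apply: val_inj.
Qed.

Lemma cube3_measurable : measurable cube3.
Proof. by apply: measurableX; [apply: measurableX|]; exact: measurable_itv. Qed.

Lemma cube3E x : cube3 x <-> forall d, 0 <= coord d x <= 1.
Proof.
split=> [[[]] /= |H].
  rewrite !in_itv /= => h0 h1 h2; exact: ord3.
by split; [split|]; rewrite /= in_itv /=;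
  [exact: (H 0)|exact: (H 1)|exact: (H (1 + 1))].
Qed.

Lemma cube_point3 x : cube (point3 x) <-> cube3 x.
Proof. by rewrite cube3E; split=> H d; have := H d; rewrite point3E. Qed.

Lemma measurable_coord d : measurable_fun setT (coord d).
Proof.
apply: (@ord3 (fun d => measurable_fun setT (coord d))).
- exact: (measurableT_comp measurable_fst measurable_fst).
- exact: (measurableT_comp measurable_snd measurable_fst).
- exact: measurable_snd.
Qed.

Lemma tame_coord (phi : R -> R) d : tame (T := R) `[0, 1] phi ->
  tame cube3 (fun x => phi (point3 x 0 d)).
Proof.
move=> [mphi [M bphi]]; split; last first.
  by exists M => x /cube3E Qx; rewrite point3E; apply: bphi; rewrite /= in_itv /=.
rewrite (_ : (fun x => _) = phi \o coord d); last by apply/funext => x /=;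
  rewrite point3E.
apply: (@measurable_comp _ _ _ _ _ _ (`[0, 1]%classic : set R) phi) => //.
- by move=> _ [x /cube3E Qx <-]; rewrite /= in_itv /=.
- by apply: measurable_funTS; exact: measurable_coord.
Qed.

Lemma cube_compact : compact (@cube R).
Proof.
rewrite (_ : cube = [set v : 'rV[R]_3 | forall i, `[0, 1]%classic (v ord0 i)]).
  exact: (@rV_compact R 3 (fun=> `[0, 1]%classic) (fun=> @segment_compact R 0 1)).
apply/seteqP; split => v /= H d; have := H d; rewrite in_itv //=.
Qed.

Definition grid (k : nat) (x : R) : R := (Num.truncn (x * k.+1%:R))%:R / k.+1%:R.

Lemma grid_dist k x : 0 <= x -> `|x - grid k x| <= k.+1%:R^-1.
Proof.
move=> x0; have k0 : 0 < (k.+1%:R : R) by rewrite ltr0n.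
have /truncn_itv /andP[t0 t1] : 0 <= x * k.+1%:R by rewrite mulr_ge0.
have -> : x = x * k.+1%:R / k.+1%:R by rewrite mulfK // gt_eqF.
rewrite /grid -mulrBl mulfK ?gt_eqF // normrM [`|_^-1|]gtr0_norm ?invr_gt0 //.
rewrite ler_piMl ?invr_ge0 // ger0_norm ?subr_ge0 // lerBlDl natr1 ltW //.
Qed.

Definition cell (k i : nat) : set R := `[i%:R / k.+1%:R, i.+1%:R / k.+1%:R[.

Lemma cellE k i x : 0 <= x -> \1_(cell k i) x = (i == Num.truncn (x * k.+1%:R))%:R :> R.
Proof.
move=> x0; have k0 : 0 < (k.+1%:R : R) by rewrite ltr0n.
rewrite indicE eq_sym truncn_eq ?mulr_ge0 // ; congr (nat_of_bool _)%:R.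
rewrite /cell; apply/idP/idP; rewrite inE /= in_itv /=.
  by rewrite ler_pdivrMr // ltr_pdivlMr.
by rewrite ler_pdivrMr // ltr_pdivlMr.
Qed.

Lemma sum_cell k (g : nat -> R) x : 0 <= x <= 1 ->
  \sum_(i < k.+2) g i * \1_(cell k i) x = g (Num.truncn (x * k.+1%:R)).
Proof.
move=> /andP[x0 x1]; have tk : (Num.truncn (x * k.+1%:R) < k.+2)%N.
  have /truncn_itv /andP[t0 t1] : 0 <= x * k.+1%:R by rewrite mulr_ge0.
  have : (Num.truncn (x * k.+1%:R))%:R <= k.+1%:R :> R.
    by rewrite (le_trans t0) // ler_piMl.
  by rewrite ler_nat ltnS.
rewrite (bigD1 (Ordinal tk)) //= cellE // eqxx mulr1 big1 ?addr0 // => i.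
by rewrite -val_eqE /= => /negbTE it; rewrite cellE // it mulr0.
Qed.

(** Boundedness is compactness of the cube.  For measurability in the product
    sigma-algebra, f is the limit of the functions that take on each box of a
    regular grid the value of f at a corner of the box. *)
Lemma tame_continuous (f : 'rV[R]_3 -> R) :
  (forall xi, cube xi -> {for xi, continuous f}) ->
  tame cube3 (fun x => f (point3 x)).
Proof.
move=> fc; split; last first.
  have [||/= |c _ fM] := @EVT_max_rV R 3 (fun x => `|f x|) cube.
  - by exists 0 => d; rewrite mxE lexx ler01.
  - exact: cube_compact.
  - apply: continuous_in_subspaceT => x /[!inE] cx.
    by apply: continuous_comp; [exact: fc|exact: norm_continuous].
  by exists `|f c| => x Qx; apply: fM; rewrite inE; apply/cube_point3.
(* The grid has k + 2 nodes, so that the face at 1 has a cell of its own. *)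
pose node k (i : nat) : R := i%:R / k.+1%:R.
pose h k x := \sum_(i < k.+2) (\sum_(j < k.+2) (\sum_(l < k.+2)
   f (point3 (node k i, node k j, node k l)) * \1_(cell k l) (coord (1 + 1) x))
     * \1_(cell k j) (coord 1 x)) * \1_(cell k i) (coord 0 x).
apply: (measurable_fun_cvg (h := h)) => [k|x /cube3E Qx].
  have mc d i : measurable_fun cube3 (fun x => \1_(cell k i) (coord d x) : R).
    apply: (@measurable_comp _ _ _ _ _ _ (setT : set R) (\1_(cell k i) : R
      -> R) cube3 (coord d)) => //.
      by apply: measurable_indic; exact: measurable_itv.
    by apply: measurable_funTS; exact: measurable_coord.
  apply: measurable_sum => i; apply: measurable_funM; last exact: mc.
  apply: measurable_sum => j; apply: measurable_funM; last exact: mc.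
  apply: measurable_sum => l; apply: measurable_funM; last exact: mc.
  exact: measurable_cst.
have hE k : h k x = f (point3 (grid k (coord 0 x), grid k (coord 1 x), grid k
  (coord (1 + 1) x))).
  rewrite /h; under eq_bigr => i _.
    under eq_bigr => j _ do rewrite (sum_cell k (fun l =>
      f (point3 (node k i, node k j, node k l)))) //.
    rewrite (sum_cell k (fun j =>
      f (point3 (node k i, node k j, grid k (coord (1 + 1) x))))) //.
    over.
  by rewrite (sum_cell k (fun i =>
    f (point3 (node k i, grid k (coord 1 x), grid k (coord (1 + 1) x))))).
apply: (cvg_trans (G :=
  f (point3 (grid k (coord 0 x), grid k (coord 1 x), grid k (coord (1 + 1) x))) @[k
    --> \oo])).
  by apply: near_eq_cvg; near=> k; rewrite hE.
have Cx : cube (point3 x) by apply/cube_point3/cube3E.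
suff pc : point3 (grid k (coord 0 x), grid k (coord 1 x), grid k (coord (1 + 1) x))
    @[k --> \oo] --> point3 x by apply: cvg_comp pc _; exact: fc.
apply/cvgrPdist_lt => _/posnumP[e]; near=> k.
apply: (@le_lt_trans _ _ (k.+1%:R^-1)); last first.
  by near: k; exact: near_infty_natSinv_lt.
rewrite /Num.Def.normr /= mx_normrE; apply: bigmax_le => // -[a d] _ /=.
rewrite ord1 !mxE; move: d; apply: ord3; apply: grid_dist.
- by case/andP: (Qx 0).
- by case/andP: (Qx 1).
- by case/andP: (Qx (1 + 1)).
Unshelve. all: by end_near. Qed.

End Cube.

(** * Integrals over the cube *)

Section IntegralCube.
Context {R : realType}.
Local Notation leb := (@lebesgue_measure R).
Local Notation leb3 := ((leb \x leb) \x leb)%E.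

Lemma leb3_box (A B C : set R) : measurable A -> measurable B -> measurable C ->
  leb3 ((A `*` B) `*` C) = (leb A * leb B * leb C)%E.
Proof.
move=> mA mB mC; rewrite product_measure1E //; last exact: measurableX.
by congr (_ * _)%E; exact: product_measure1E.
Qed.

Lemma integrable_tame (f : R * R * R -> R) : tame cube3 f ->
  leb3.-integrable cube3 (EFin \o f).
Proof.
move=> [mf [M bf]]; apply: measurable_bounded_integrable => //.
- exact: cube3_measurable.
- have E : (leb3 cube3 < +oo)%E; last exact: E.
  rewrite /cube3 leb3_box //; try exact: measurable_itv.
  by rewrite !lebesgue_measure_itv /= lte_fin ltr01 oppr0 adde0 !mule1 ltry.
- exists M; split; first exact: num_real.
  by move=> N MN x Qx /=; apply: (le_trans (bf _ Qx)); exact: ltW.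
Qed.

Lemma integral_cube_sum (J : Type) (s : seq J) (c : J -> R) (f : J -> 'rV[R]_3 -> R) :
  (forall j, tame cube3 (fun x => f j (point3 x))) ->
  \sum_(j <- s) c j * integral_cube (f j) =
  integral_cube (fun xi => \sum_(j <- s) c j * f j xi).
Proof.
move=> tf; have mQ := @cube3_measurable R.
elim: s => [|j s IH].
  rewrite big_nil /integral_cube.
  under eq_Rintegral do rewrite big_nil.
  by rewrite Rintegral_cst // mul0r.
rewrite big_cons IH /integral_cube.
under [RHS]eq_Rintegral do rewrite big_cons.
have tc j' : tame cube3 (fun x => c j' * f j' (point3 x)).
  by apply: tameM; [exact: tame_cst|exact: tf].
rewrite RintegralD //; first last.
- apply: integrable_tame; exact: tame_sum.
- exact: integrable_tame.
by rewrite RintegralZl //; exact: integrable_tame.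
Qed.

(** A nonnegative function with integral zero has a zero in each box of positive
    measure.  The box has its lower corner at a and is cut off at 1, as only
    right-continuity will be available, on [0,1). *)
Lemma integral_cube_eq0 (f : 'rV[R]_3 -> R) : tame cube3 (fun x => f (point3 x)) ->
  (forall xi, cube xi -> 0 <= f xi) -> integral_cube f = 0 ->
  forall (a : R * R * R) (e : R), (forall d, 0 <= coord d a < 1) -> 0 < e ->
  exists x, (forall d, coord d a <= coord d x < Num.min (coord d a + e) 1) /\
    f (point3 x) = 0.
Proof.
move=> tf f0 If a e a01 e0; have mQ := @cube3_measurable R.
have Ifin : (\int[leb3]_(x in cube3) (f (point3 x))%:E \is a fin_num)%E.
  by apply: integrable_fin_num; [exact: mQ|exact: (integrable_tame tf)].
have If0 : (\int[leb3]_(x in cube3) `|(f (point3 x))%:E| = 0)%E.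
  transitivity (\int[leb3]_(x in cube3) (f (point3 x))%:E)%E.
    apply: eq_integral => x /[!inE] Qx; rewrite gee0_abs // lee_fin.
    by apply: f0; exact/cube_point3.
  by rewrite -(fineK Ifin); congr EFin; exact: If.
have [N [mN N0 QN]] : ae_eq leb3 cube3 (fun x => (f (point3 x))%:E) (cst 0%E).
  apply/ae_eq_integral_abs => //.
  by apply/measurable_EFinP; case: tf.
pose I d : set R := `[coord d a, Num.min (coord d a + e) 1[%classic.
have Ipos d : (0 < leb (I d))%E.
  have lt : coord d a < Num.min (coord d a + e) 1.
    by rewrite lt_min ltrDl e0; case/andP: (a01 d).
  by rewrite lebesgue_measure_itv /= lte_fin lt -EFinB lte_fin subr_gt0.
pose B := (I 0 `*` I 1) `*` I (1 + 1).
have Bpos : (0 < leb3 B)%E.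
  by rewrite leb3_box //; try exact: measurable_itv; rewrite !mule_gt0.
apply: contrapT => Hno.
have BN : B `<=` N.
  move=> x [[]] /=; rewrite /I /= !in_itv /= => x0 x1 x2; apply: QN => /= Qf.
  apply: Hno; exists x.
  have Hx d : coord d a <= coord d x < Num.min (coord d a + e) 1.
    by move: d; exact: ord3.
  split => //; apply: EFin_inj; apply: Qf; apply/cube3E => d.
  have /andP[ax xb] := Hx d; have /andP[a0 a1] := a01 d.
  by rewrite (le_trans a0 ax) /= ltW // (lt_le_trans xb) // ge_min lexx orbT.
have : (leb3 B <= leb3 N)%E.
  apply: le_measure; rewrite ?inE //.
  by apply: measurableX; [apply: measurableX|]; exact: measurable_itv.
by rewrite [leb3 N]N0 leNgt Bpos.
Qed.

End IntegralCube.

(** * Tensor product splines *)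

Section TensorSplines.
Context {R : realType} (p : nat) (n : 'I_3 -> nat).
Hypotheses (p_gt0 : (0 < p)%N) (n_gt0 : forall d, (0 < n d)%N).

Lemma vector_basis_mulE (low : 'I_3 -> 'I_3 -> bool) (e : 'cV[R]_#|vector_index p n
  low|) xi i :
  (vector_basis p n low xi *m e) i 0 =
  \sum_j (if tag (enum_val j) == i then e j 0 else 0) *
    tensor_spline (tagged (enum_val j)) xi.
Proof.
rewrite mxE; apply: eq_bigr => j _; rewrite mxE.
by case: ifP; rewrite ?mul0r // mulrC.
Qed.

Lemma apply_functional (J : finType) (c : J -> R) (phi : J -> R -> R)
    K (x a : 'I_K -> R) :
  (forall s, 0 <= x s < 1) ->
  (forall y, 0 <= y < 1 -> \sum_j c j * phi j y = 0) ->
  \sum_j c j * (\sum_s a s * phi j (x s)) = 0.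
Proof.
move=> x01 H; under eq_bigr do rewrite mulr_sumr.
rewrite exchange_big /= big1 // => s _.
under eq_bigr do rewrite mulrCA.
by rewrite -mulr_sumr H ?mulr0.
Qed.

Lemma tensor_splineE low (f : tensor_index p n low) (x : R * R * R) :
  tensor_spline f (point3 x) =
  spline (n 0) p 0 (low 0) (f 0) x.1.1 * spline (n 1) p 1 (low 1) (f 1) x.1.2 *
  spline (n (1 + 1)) p (1 + 1) (low (1 + 1)) (f (1 + 1)) x.2.
Proof.
rewrite /tensor_spline !big_ord_recl big_ord0 mulr1 mulrA.
have e1 : lift ord0 ord0 = 1 :> 'I_3 by exact: val_inj.
have e2 : lift ord0 (lift ord0 ord0) = 1 + 1 :> 'I_3 by exact: val_inj.
by rewrite e2 e1 !point3E.
Qed.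

(** The three functionals dual to the factors of one tensor product spline are
    applied one after the other; they kill all the other ones. *)
Lemma vector_basis_free (low : 'I_3 -> 'I_3 -> bool) (e : 'cV[R]_#|vector_index p n
  low|) :
  (forall a, (forall d, 0 <= coord d a < 1) -> vector_basis p n low (point3 a) *m e =
    0) ->
  e = 0.
Proof.
move=> H; apply/colP => k; rewrite mxE.
pose i := tag (enum_val k); pose g : tensor_index p n (low i) := tagged (enum_val k).
pose c j := if tag (enum_val j) == i then e j 0 else 0.
pose sp d (j : 'I_#|vector_index p n low|) :=
  spline (n d) p d (low (tag (enum_val j)) d) (tagged (enum_val j) d) : R -> R.
have H1 x y z : 0 <= x < 1 -> 0 <= y < 1 -> 0 <= z < 1 ->
    \sum_j c j * sp (1 + 1) j z * sp 1 j y * sp 0 j x = 0.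
  move=> x01 y01 z01.
  have /matrixP/(_ i 0) := H (x, y, z) (ord3 (P := fun d =>
    is_true (0 <= coord d (x, y, z) < 1)) x01 y01 z01).
  rewrite vector_basis_mulE mxE => E; rewrite -[RHS]E.
  apply: eq_bigr => j _; rewrite tensor_splineE -!mulrA; congr (_ * _).
  by rewrite /sp; ring.
have D d : dual_nodes (spline (n d) p d (low i d)) (spline_count (n d) p d (low i d))
  (g d) (R := R).
  by apply: spline_dual.
have [K0 [x0 [a0 [x01 E0]]]] := D 0.
have [K1 [x1 [a1 [x11 E1]]]] := D 1.
have [K2 [x2 [a2 [x21 E2]]]] := D (1 + 1).
have H2 y z : 0 <= y < 1 -> 0 <= z < 1 ->
    \sum_j c j * sp (1 + 1) j z * (\sum_s a0 s * sp 0 j (x0 s)) * sp 1 j y = 0.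
  move=> y01 z01.
  have := @apply_functional _ (fun j => c j * sp (1 + 1) j z * sp 1 j y) (sp 0) _ x0
    a0 x01.
  move=> /(_ (fun x h => H1 x y z h y01 z01)) E; rewrite -[RHS]E.
  by apply: eq_bigr => j _; rewrite mulrAC.
have H3 z : 0 <= z < 1 ->
    \sum_j c j * (\sum_s a0 s * sp 0 j (x0 s)) * (\sum_s a1 s * sp 1 j (x1 s))
       * sp (1 + 1) j z = 0.
  move=> z01.
  have := @apply_functional _ (fun j =>
    c j * sp (1 + 1) j z * (\sum_s a0 s * sp 0 j (x0 s))) (sp 1) _ x1 a1 x11.
  move=> /(_ (fun y h => H2 y z h z01)) E; rewrite -[RHS]E.
  by apply: eq_bigr => j _; rewrite mulrAC; congr (_ * _); rewrite mulrAC.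
have F0 : \sum_s a0 s * sp 0 k (x0 s) = 1.
  by apply: etrans (E0 (g 0) (ltn_ord _)) _; rewrite eqxx.
have F1 : \sum_s a1 s * sp 1 k (x1 s) = 1.
  by apply: etrans (E1 (g 1) (ltn_ord _)) _; rewrite eqxx.
have F2 : \sum_s a2 s * sp (1 + 1) k (x2 s) = 1.
  by apply: etrans (E2 (g (1 + 1)) (ltn_ord _)) _; rewrite eqxx.
have := apply_functional a2 x21 H3.
rewrite (bigD1 k) //= [X in _ + X]big1 ?addr0 => [|j jk].
  by rewrite F0 F1 F2 !mulr1 /c eqxx.
rewrite /c; case: ifP => [/eqP ji|_]; last by rewrite !mul0r.
have : enum_val j != enum_val k by rewrite (inj_eq enum_val_inj).
rewrite /sp; move: E0 E1 E2; rewrite /g /i in ji *.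
case: (enum_val j) (enum_val k) ji => [j1 f] [k1 g'] /= jk1.
case: _ / (esym jk1) f => f E0 E1 E2 fg.
have : f != g' by apply: contra_neq fg => ->.
rewrite E0 // E1 // E2 // => fg'.
have [f0|] := eqVneq (f 0 : nat) (g' 0); last by rewrite mulr0 !mul0r.
have [f1|] := eqVneq (f 1 : nat) (g' 1); last by rewrite mulr0 !mul0r.
have [f2|] := eqVneq (f (1 + 1) : nat) (g' (1 + 1)); last by rewrite mulr0.
exfalso; move/eqP: fg'; apply; apply/ffunP.
by apply: ord3; apply: val_inj.
Qed.

End TensorSplines.

(** * The mass matrices *)

Section MassMatrix.
Context {R : realType} (p : nat) (n : 'I_3 -> nat).

(** Each factor of each spline is evaluated along a sequence that tends to a
    coordinate of a from above. *)
Lemma vector_basis_right_cts (low : 'I_3 -> 'I_3 -> bool) (e : 'cV[R]_#|vector_index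
  p n low|)
    i (a : R * R * R) (y : nat -> R * R * R) :
  (forall d, 0 <= coord d a < 1) ->
  (forall k d, coord d a <= coord d (y k) < coord d a + k.+1%:R^-1) ->
  (vector_basis p n low (point3 (y k)) *m e) i 0 @[k --> \oo] -->
  (vector_basis p n low (point3 a) *m e) i 0.
Proof.
move=> a01 ya.
have yc d : coord d (y k) @[k --> \oo] --> within [set x | coord d a <= x]
  (nbhs (coord d a)).
  move=> P /= [r r0 rP]; suff : \forall k \near \oo, P (coord d (y k)) by [].
  near=> k; apply: rP; last by case/andP: (ya k d).
  rewrite /= -opprB normrN; have /andP[yl yu] := ya k d.
  rewrite ger0_norm ?subr_ge0 // ltrBlDl (lt_trans yu) // ltrD2l.
  by near: k; exact: (near_infty_natSinv_lt (PosNum r0)).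
rewrite vector_basis_mulE.
under eq_cvg do rewrite vector_basis_mulE.
apply: cvg_big => [|j _]; first exact: add_continuous.
apply: cvgM; first exact: cvg_cst.
apply: cvg_big => [|d _]; first exact: mul_continuous.
rewrite point3E; under eq_cvg do rewrite point3E.
apply: cvg_comp (yc d) _.
exact: right_cts_spline.
Unshelve. all: by end_near. Qed.

Lemma tame_vector_basis (low : 'I_3 -> 'I_3 -> bool) i j :
  tame cube3 (fun x => @vector_basis R p n low (point3 x) i j).
Proof.
rewrite (_ : (fun x => _) = fun x => if tag (enum_val j) == i then
    tensor_spline (tagged (enum_val j)) (point3 x) else 0); last first.
  by apply/funext => x; rewrite mxE.
case: (tag (enum_val j) == i); last exact: tame_cst.
by apply: tame_prod => d; apply: tame_coord; exact: tame_spline.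
Qed.

Context (F : 'rV[R]_3 -> 'rV[R]_3) (Omega : set 'rV[R]_3).
Hypothesis hF : coordinate_map F Omega.

Lemma DF_unit xi : cube xi -> DF F xi \in unitmx.
Proof. by case: hF => _ _ _ J0 /J0; rewrite unitmxE unitfE. Qed.

Lemma cube_DF_differentiable xi : cube xi -> mx_differentiable (DF F) xi.
Proof.
by case: hF => -[U [oU cU sU]] _ _ _ cxi; apply: (DF_differentiable oU sU); exact: cU.
Qed.

Lemma Gm_unit xi : cube xi -> Gm F xi \in unitmx.
Proof. by move=> cxi; rewrite unitmx_mul unitmx_tr DF_unit. Qed.

Lemma Gm_sym xi : (Gm F xi)^T = Gm F xi.
Proof. by rewrite /Gm trmx_mul trmxK. Qed.

Lemma tame_metric i j :
  tame cube3 (fun x => invmx (Gm F (point3 x)) i j * `|JF F (point3 x)|).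
Proof.
apply: (tame_continuous (f := fun xi => invmx (Gm F xi) i j * `|JF F xi|)) => xi cxi.
have dD := cube_DF_differentiable cxi.
apply: continuousM.
  apply: differentiable_continuous; apply: differentiable_invmx; last exact: Gm_unit.
  by apply: differentiable_mulmx => //; exact: differentiable_trmx.
apply: continuous_comp; last exact: norm_continuous.
exact/differentiable_continuous/differentiable_det.
Qed.

Lemma tame_mass1 i j : tame cube3 (fun x =>
  ((Lambda1 p n (point3 x))^T *m invmx (Gm F (point3 x)) *m Lambda1 p n (point3 x)) i j
  * `|JF F (point3 x)|).
Proof.
rewrite (_ : (fun x => _) = fun x => \sum_k \sum_l Lambda1 p n (point3 x) l i *
    (invmx (Gm F (point3 x)) l k * `|JF F (point3 x)|) * Lambda1 p n (point3 x) k j).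
  apply: tame_sum => k; apply: tame_sum => l.
  apply: tameM; last exact: tame_vector_basis.
  by apply: tameM; [exact: tame_vector_basis|exact: tame_metric].
apply/funext => x; rewrite mxE mulr_suml; apply: eq_bigr => k _.
rewrite mxE !mulr_suml; apply: eq_bigr => l _.
by rewrite !mxE mulrAC !mulrA.
Qed.

Lemma mass1_integrandE (v : 'rV[R]_(dim1 p n)) xi :
  ((Lambda1 p n xi *m v^T)^T *m invmx (Gm F xi) *m (Lambda1 p n xi *m v^T)) 0 0
    * `|JF F xi| =
  \sum_j v 0 j * (\sum_i v 0 i *
   (((Lambda1 p n xi)^T *m invmx (Gm F xi) *m Lambda1 p n xi) i j * `|JF F xi|)).
Proof.
have -> : (Lambda1 p n xi *m v^T)^T *m invmx (Gm F xi) *m (Lambda1 p n xi *m v^T) =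
  v *m ((Lambda1 p n xi)^T *m invmx (Gm F xi) *m Lambda1 p n xi) *m v^T.
  by rewrite trmx_mul trmxK !mulmxA.
rewrite mxE mulr_suml; apply: eq_bigr => j _.
rewrite [v^T _ _]mxE mxE mulr_sumr !mulr_suml; apply: eq_bigr => i _.
ring.
Qed.

Lemma mass1_quadratic (v : 'rV[R]_(dim1 p n)) :
  (v *m mass1 p n F *m v^T) 0 0 = integral_cube (fun xi =>
    ((Lambda1 p n xi *m v^T)^T *m invmx (Gm F xi) *m (Lambda1 p n xi *m v^T)) 0 0
    * `|JF F xi|).
Proof.
transitivity (\sum_j v 0 j * integral_cube (fun xi => \sum_i v 0 i *
   (((Lambda1 p n xi)^T *m invmx (Gm F xi) *m Lambda1 p n xi) i j * `|JF F xi|))).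
  rewrite mxE; apply: eq_bigr => j _; rewrite [v^T _ _]mxE mulrC; congr (_ * _).
  rewrite -integral_cube_sum => [|i]; last exact: tame_mass1.
  by rewrite mxE; apply: eq_bigr => i _; rewrite [mass1 _ _ _ _ _]mxE.
rewrite integral_cube_sum => [|j]; last first.
  by apply: tame_sum => i; apply: tameM; [exact: tame_cst|exact: tame_mass1].
by congr integral_cube; apply/funext => xi; rewrite mass1_integrandE.
Qed.

(** G_m^-1 = DF^-1 DF^-T. *)
Lemma metric_pos xi (w : 'cV[R]_3) : cube xi ->
  (w^T *m invmx (Gm F xi) *m w) 0 0 = \sum_i ((invmx (DF F xi))^T *m w) i 0 ^+ 2.
Proof.
move=> cxi; have uD := DF_unit cxi.
have -> : invmx (Gm F xi) = invmx (DF F xi) *m (invmx (DF F xi))^T.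
  apply: (can_inj (mulKmx (Gm_unit cxi))).
  rewrite mulmxV ?Gm_unit // /Gm -!mulmxA mulKVmx // -trmx_mul mulVmx //.
  by rewrite trmx1.
rewrite mulmxA -mulmxA -{1}[invmx (DF F xi)]trmxK -trmx_mul mxE.
by apply: eq_bigr => i _; rewrite mxE expr2.
Qed.

Hypotheses (p_gt0 : (0 < p)%N) (n_gt0 : forall d, (0 < n d)%N).

(** A null vector makes the integral of a nonnegative function vanish, so that
    its spline field vanishes at points arbitrarily close to any point a of
    [0,1)^3, from above, hence at a. *)
Lemma mass1_unit : mass1 p n F \in unitmx.
Proof.
rewrite -row_free_unit; apply: inj_row_free => v vM.
apply: trmx_inj; rewrite trmx0; apply: (vector_basis_free p_gt0 n_gt0) => a a01.
pose h xi :=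
  ((Lambda1 p n xi *m v^T)^T *m invmx (Gm F xi) *m (Lambda1 p n xi *m v^T)) 0 0
    * `|JF F xi|.
have Ih : integral_cube h = 0 by rewrite -mass1_quadratic vM mul0mx mxE.
have h0 xi : cube xi -> 0 <= h xi.
  by move=> cxi; rewrite /h metric_pos // mulr_ge0 // sumr_ge0 // => i _;
    exact: sqr_ge0.
have th : tame cube3 (fun x => h (point3 x)).
  apply: tame_eq (fun x _ => esym (mass1_integrandE v (point3 x))) _.
  apply: tame_sum => j; apply: tameM; first exact: tame_cst.
  by apply: tame_sum => i; apply: tameM; [exact: tame_cst|exact: tame_mass1].
have zero_near k : exists x, (forall d, coord d a <= coord d x < coord d a
  + k.+1%:R^-1) /\
    Lambda1 p n (point3 x) *m v^T = 0.
  have [|x [ax hx]] := integral_cube_eq0 th h0 Ih a01 (e := k.+1%:R^-1);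
    first by rewrite invr_gt0.
  exists x; split => [d|]; first by have := ax d; rewrite lt_min => /and3P[-> ->].
  have cx : cube (point3 x).
    move=> d; rewrite point3E; have := ax d; rewrite lt_min => /and3P[ax1 _ /ltW ->].
    by rewrite (le_trans _ ax1) //; case/andP: (a01 d).
  move: hx; rewrite /h metric_pos // => /eqP; rewrite mulf_eq0 normr_eq0.
  case: hF => _ _ _ /(_ _ cx) /negbTE ->; rewrite orbF psumr_eq0 => [|i _];
    last exact: sqr_ge0.
  move=> /allP Hi.
  have : (invmx (DF F (point3 x)))^T *m (Lambda1 p n (point3 x) *m v^T) = 0.
    apply/colP => i; rewrite [RHS]mxE; apply/eqP; rewrite -sqrf_eq0.
    by apply: Hi; rewrite mem_index_enum.
  move/(congr1 (mulmx (DF F (point3 x))^T));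
    rewrite mulmxA -trmx_mul mulVmx ?DF_unit //.
  by rewrite trmx1 mul1mx mulmx0.
have [y ya] := choice zero_near.
apply/colP => i; rewrite [RHS]mxE.
have := vector_basis_right_cts (low := low1) (e := v^T) (i := i) a01 (fun k =>
  (ya k).1).
rewrite (_ : (fun k => _) = cst 0); last first.
  by apply/funext => k; rewrite [LHS](congr1 (fun M : 'cV[R]_3 => M i 0) (ya k).2) mxE.
by move/cvg_lim => <- //; rewrite lim_cst.
Qed.

Lemma mass1_sym : (mass1 p n F)^T = mass1 p n F.
Proof.
apply/matrixP => i j; rewrite !mxE; congr integral_cube; apply/funext => xi.
congr (_ * _); set M := _ *m _ *m _.
have MT : M^T = M by rewrite !trmx_mul trmxK trmx_inv Gm_sym mulmxA.
by rewrite -{1}MT [LHS]mxE.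
Qed.

Lemma mass2_sym : (mass2 p n F)^T = mass2 p n F.
Proof.
apply/matrixP => i j; rewrite !mxE; congr integral_cube; apply/funext => xi.
congr (_ * _); set M := _ *m _ *m _.
have MT : M^T = M by rewrite 2!trmx_mul trmxK Gm_sym mulmxA.
by rewrite -{1}MT [LHS]mxE.
Qed.

End MassMatrix.

(** * The Poisson matrix as a bilinear form *)

Section Blocks.
Context {R : realType}.

Definition dot n (x y : 'cV[R]_n) : R := (x^T *m y) 0 0.

Lemma dotC n (x y : 'cV[R]_n) : dot x y = dot y x.
Proof. by rewrite /dot -[y in LHS]trmxK -trmx_mul mxE. Qed.

Lemma dot_mull m n (M : 'M[R]_(m, n)) x y : dot (M *m x) y = dot x (M^T *m y).
Proof. by rewrite /dot trmx_mul mulmxA. Qed.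

Lemma dotDr n (x y z : 'cV[R]_n) : dot x (y + z) = dot x y + dot x z.
Proof. by rewrite /dot mulmxDr mxE. Qed.
Lemma dotDl n (x y z : 'cV[R]_n) : dot (x + y) z = dot x z + dot y z.
Proof. by rewrite !(dotC _ z) dotDr. Qed.
Lemma dotZr n c (x y : 'cV[R]_n) : dot x (c *: y) = c * dot x y.
Proof. by rewrite /dot -scalemxAr mxE. Qed.
Lemma dotZl n c (x y : 'cV[R]_n) : dot (c *: x) y = c * dot x y.
Proof. by rewrite dotC dotZr dotC. Qed.
Lemma dotNr n (x y : 'cV[R]_n) : dot x (- y) = - dot x y.
Proof. by rewrite -scaleN1r dotZr mulN1r. Qed.
Lemma dot0r n (x : 'cV[R]_n) : dot x 0 = 0.
Proof. by rewrite /dot mulmx0 mxE. Qed.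

Lemma dot_col_mx m n (x1 y1 : 'cV[R]_m) (x2 y2 : 'cV[R]_n) :
  dot (col_mx x1 x2) (col_mx y1 y2) = dot x1 y1 + dot x2 y2.
Proof. by rewrite /dot tr_col_mx mul_row_col mxE. Qed.

Context (N : nat) (r : 'I_N -> nat).

Lemma dot_submxcol (x y : 'cV[R]_(\sum_k r k)) :
  dot x y = \sum_k dot (submxcol x k) (submxcol y k).
Proof.
rewrite -{1}[x]submxcolK -{1}[y]submxcolK /dot tr_mxcol mul_mxrow_mxcol summxE.
by apply: eq_bigr.
Qed.

Lemma submxcol_mxdiag n (B : forall k, 'M[R]_(r k)) (X : 'M[R]_(\sum_k r k, n)) k :
  submxcol (\mxdiag_k B k *m X) k = B k *m submxcol X k.
Proof. by rewrite -{1}[X]submxcolK mul_mxdiag_mxcol mxcolK. Qed.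

Lemma mul_mxdiag (B D : forall k, 'M[R]_(r k)) :
  \mxdiag_k B k *m \mxdiag_k D k = \mxdiag_k (B k *m D k).
Proof.
apply/mxcolP => k; rewrite submxcol_mxdiag.
by rewrite -[\mxdiag_k D k]mulmx1 -[\mxdiag_k (B k *m D k)]mulmx1 !submxcol_mxdiag
  mulmxA.
Qed.

Lemma invmx_mxdiag (c : 'I_N -> R) : (forall k, c k != 0) ->
  (\mxdiag_k (c k)%:M : 'M[R]_(\sum_k r k)) \in unitmx /\
  invmx (\mxdiag_k (c k)%:M : 'M[R]_(\sum_k r k)) = \mxdiag_k ((c k)^-1)%:M.
Proof.
move=> c0.
have E : (\mxdiag_k (c k)%:M : 'M[R]_(\sum_k r k)) *m \mxdiag_k ((c k)^-1)%:M = 1%:M.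
  rewrite mul_mxdiag -mxdiagZ; apply: eq_mxdiag => k.
  by rewrite -scalar_mxM mulfV.
have [u _] := mulmx1_unit E; split => //.
by rewrite -[RHS](mulKmx u) E mulmx1.
Qed.

End Blocks.

Section PoissonMatrix.
Context {R : realType} (p : nat) (n : 'I_3 -> nat).
Context (F : 'rV[R]_3 -> 'rV[R]_3) (Np : nat) (omega q m : 'I_Np -> R).
Context (C : 'M[R]_(dim2 p n, dim1 p n)).
Hypotheses (homega : forall k, omega k != 0) (hm : forall k, 0 < m k).

Local Notation M1 := (mass1 p n F).
Local Notation state := 'cV[R]_(state_dim p n Np).
Local Notation J := (poisson_mx F omega q m C).

Lemma Wm_inv : W_m omega m \in unitmx /\
  invmx (W_m omega m) = \mxdiag_(k < Np) ((omega k * m k)^-1)%:M.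
Proof.
by apply: (@invmx_mxdiag R Np (fun=> 3%N) (fun k => omega k * m k)) => k;
  rewrite mulf_neq0 // gt_eqF.
Qed.

Lemma stateE (u : state) :
  u = col_mx (col_mx (st_Xi u) (st_V u)) (col_mx (st_e u) (st_b u)).
Proof. by rewrite !vsubmxK. Qed.

Definition particle_pos (k : 'I_Np) (v : state) : 'rV[R]_3 := position (st_Xi v) k.
Definition xi_part (k : 'I_Np) (v : state) : 'cV[R]_3 := submxcol (st_Xi v) k.
Definition v_part (k : 'I_Np) (v : state) : 'cV[R]_3 := submxcol (st_V v) k.
Definition inv_mass_e (a : state) : 'cV[R]_(dim1 p n) := invmx M1 *m st_e a.
Definition inv_DF (k : 'I_Np) (v : state) : 'M[R]_3 := invmx (DF F (particle_pos k v)).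
(** The factor q / m stays with the spline fields in [charged_rot] and
    [charged_Lambda1], so that for q = 0 these are constant, whatever the
    regularity of the splines at the particle. *)
Definition charged_rot (k : 'I_Np) (v : state) : 'M[R]_3 :=
  (q k / m k) *: rot_mx (Lambda2 p n (particle_pos k v) *m st_b v).
Definition charged_Lambda1 (k : 'I_Np) (v : state) : 'M[R]_(3, dim1 p n) :=
  (q k / m k) *: Lambda1 p n (particle_pos k v).

(** The share of particle k in a^T J b. *)
Definition particle_form (k : 'I_Np) (v a b : state) : R :=
  (omega k * m k)^-1 * (dot (xi_part k a) (inv_DF k v *m v_part k b)
                        - dot (xi_part k b) (inv_DF k v *m v_part k a))
  + (omega k * m k)^-1 *
      dot (inv_DF k v *m v_part k a) (charged_rot k v *m (inv_DF k v *m v_part k b))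
  + (dot (inv_DF k v *m v_part k a) (charged_Lambda1 k v *m inv_mass_e b)
     - dot (inv_DF k v *m v_part k b) (charged_Lambda1 k v *m inv_mass_e a)).

Lemma Nmx_T xi : (Nmx F xi)^T = invmx (DF F xi).
Proof. by rewrite trmxK. Qed.

Lemma poisson_mul (u b : state) :
  J u *m b = col_mx
    (col_mx ((NN F (st_Xi u))^T *m (invmx (W_m omega m) *m st_V b))
       (- (invmx (W_m omega m) *m (NN F (st_Xi u) *m st_Xi b))
        + W_qm q m *m (NN F (st_Xi u) *m (BB (st_Xi u) (st_b u) *m
             ((NN F (st_Xi u))^T *m (invmx (W_m omega m) *m st_V b))))
        + W_qm q m *m (NN F (st_Xi u) *m (LL1 p n (st_Xi u) *m inv_mass_e b))))
    (col_mx (- (invmx M1 *m ((LL1 p n (st_Xi u))^T *m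
                  ((NN F (st_Xi u))^T *m (W_qm q m *m st_V b))))
       + invmx M1 *m (C^T *m st_b b))
       (- (C *m inv_mass_e b))).
Proof.
rewrite {1}[b]stateE /poisson_mx mul_block_col !mul_block_col.
rewrite !add_col_mx !mul0mx !addr0 !add0r !mulNmx -!mulmxA.
by [].
Qed.

(** The symmetry of M_1 lets M_1^-1 act on the e-component of the covector on
    either side, which is why only [inv_mass_e] appears. *)
Lemma poisson_form (u a b : state) : (mass1 p n F)^T = mass1 p n F ->
  dot a (J u *m b) = \sum_k particle_form k u a b +
    (dot (inv_mass_e a) (C^T *m st_b b) - dot (inv_mass_e b) (C^T *m st_b a)).
Proof.
move=> M1s; have iM1 : (invmx M1)^T = invmx M1 by rewrite trmx_inv M1s.
have [_ Wi] := Wm_inv.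
rewrite poisson_mul {1}[a]stateE !dot_col_mx !dotDr !dotNr.
have -> : dot (st_e a) (invmx M1 *m (C^T *m st_b b)) =
  dot (inv_mass_e a) (C^T *m st_b b).
  by rewrite /inv_mass_e dot_mull iM1.
have -> : dot (st_b a) (C *m inv_mass_e b) = dot (inv_mass_e b) (C^T *m st_b a).
  by rewrite dotC dot_mull.
have NT : (NN F (st_Xi u))^T = \mxdiag_(k < Np) inv_DF k u.
  by rewrite tr_mxdiag; apply: eq_mxdiag => k; rewrite Nmx_T.
have pX x y : dot x ((NN F (st_Xi u))^T *m (invmx (W_m omega m) *m y)) =
    \sum_k (omega k * m k)^-1 * dot (submxcol x k) (inv_DF k u *m submxcol y k).
  rewrite dot_submxcol; apply: eq_bigr => k _.
  by rewrite NT Wi !submxcol_mxdiag mul_scalar_mx -scalemxAr dotZr.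
have -> : dot (st_V a) (invmx (W_m omega m) *m (NN F (st_Xi u) *m st_Xi b)) =
    \sum_k (omega k * m k)^-1 * dot (xi_part k b) (inv_DF k u *m v_part k a).
  have WT : (invmx (W_m omega m))^T = invmx (W_m omega m).
    by rewrite Wi tr_mxdiag; apply: eq_mxdiag => k; rewrite tr_scalar_mx.
  by rewrite -pX dotC !dot_mull WT.
rewrite pX.
have pV (c : state) (y : 'cV[R]_(\sum_(k < Np) 3)) :
    dot (st_V c) (W_qm q m *m (NN F (st_Xi u) *m y)) =
    \sum_k q k / m k * dot (inv_DF k u *m v_part k c) (submxcol y k).
  rewrite dot_submxcol; apply: eq_bigr => k _.
  rewrite !submxcol_mxdiag mul_scalar_mx dotZr; congr (_ * _).
  by rewrite dot_mull.
have -> : dot (st_e a) (invmx M1 *m ((LL1 p n (st_Xi u))^T *m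
      ((NN F (st_Xi u))^T *m (W_qm q m *m st_V b)))) =
    dot (st_V b) (W_qm q m *m (NN F (st_Xi u) *m (LL1 p n (st_Xi u) *m inv_mass_e a))).
  have WT : (W_qm q m)^T = W_qm q m.
    by rewrite tr_mxdiag; apply: eq_mxdiag => k; rewrite tr_scalar_mx.
  by rewrite [RHS]dotC !dot_mull WT iM1.
have pL (c : state) k : submxcol (LL1 p n (st_Xi u) *m inv_mass_e c) k =
    Lambda1 p n (particle_pos k u) *m inv_mass_e c by rewrite -submxcol_mul mxcolK.
rewrite !pV.
set S1 := \sum_k _; set S2 := \sum_k _; set S3 := \sum_k _; set S4 := \sum_k _.
set S5 := \sum_k _.
have -> : \sum_k particle_form k u a b = S1 - S2 + S3 + S4 - S5.
  rewrite -!sumrN -!big_split /=; apply: eq_bigr => k _.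
  rewrite /particle_form /charged_rot /charged_Lambda1 !pL !submxcol_mxdiag NT
    !submxcol_mxdiag Wi submxcol_mxdiag.
  rewrite mul_scalar_mx -!scalemxAr -!scalemxAl -?scalemxAr !dotZr.
  rewrite -/(v_part k b) -/(v_part k a) -/(xi_part k a) -/(particle_pos k u); ring.
ring.
Qed.

End PoissonMatrix.

(** * Hamiltonian form of the equations, skew-symmetry *)

Lemma derive_quadratic (R : realType) (V : normedModType R) (f : V -> R) x v (a b : R) :
  (forall h, f (h *: v + x) = f x + h * a + h ^+ 2 * b) -> 'D_v f x = a.
Proof.
move=> fE; apply: cvg_lim => //.
apply: (cvg_trans (G := (fun h : R => a + h * b) @ 0^')).
  apply: near_eq_cvg; near=> h.
  have h0 : h != 0 by near: h; exact: nbhs_dnbhs_neq.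
  rewrite /= fE -[_ *: _]/(_ * _); field.
  exact: h0.
suff : (fun h : R => a + h * b) @ 0^' --> a + 0 * b by rewrite mul0r addr0.
apply: cvgD; first exact: cvg_cst.
apply: cvgM; last exact: cvg_cst.
by apply: cvg_within_filter; exact: cvg_id.
Unshelve. all: by end_near. Qed.

Section EquationsOfMotion.
Context {R : realType} (p : nat) (n : 'I_3 -> nat).
Context (F : 'rV[R]_3 -> 'rV[R]_3) (Np : nat) (omega q m : 'I_Np -> R).
Context (C : 'M[R]_(dim2 p n, dim1 p n)).
Hypotheses (homega : forall k, omega k != 0) (hm : forall k, 0 < m k).
Hypotheses (M1_unit : mass1 p n F \in unitmx) (M1_sym : (mass1 p n F)^T = mass1 p n F)
  (M2_sym : (mass2 p n F)^T = mass2 p n F).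

Local Notation state := 'cV[R]_(state_dim p n Np).
Local Notation J := (poisson_mx F omega q m C).
Local Notation H := (hamiltonian F omega m).
Local Notation M1 := (mass1 p n F).
Local Notation M2 := (mass2 p n F).
Local Notation W := (W_m omega m).

Definition energy_gradient (u : state) : state :=
  col_mx (col_mx 0 (W *m st_V u)) (col_mx (M1 *m st_e u) (M2 *m st_b u)).

Lemma dot_quadratic d (S : 'M[R]_d) (x y : 'cV[R]_d) h : S^T = S ->
  dot (h *: y + x) (S *m (h *: y + x)) =
  dot x (S *m x) + h * (2 * dot y (S *m x)) + h ^+ 2 * dot y (S *m y).
Proof.
move=> St; rewrite mulmxDr -scalemxAr !dotDr !dotDl !dotZr !dotZl.
rewrite -[dot x (S *m y)]dotC dot_mull St; ring.
Qed.

Lemma hamiltonianE (u : state) : H u = 2^-1 * dot (st_V u) (W *m st_V u)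
   + 2^-1 * dot (st_e u) (M1 *m st_e u) + 2^-1 * dot (st_b u) (M2 *m st_b u).
Proof. by rewrite /hamiltonian /dot !mulmxA. Qed.

Lemma W_sym : W^T = W.
Proof. by rewrite tr_mxdiag; apply: eq_mxdiag => k; rewrite tr_scalar_mx. Qed.

Lemma gradient_hamiltonian (u : state) : gradient H u = energy_gradient u.
Proof.
apply/colP => i; rewrite mxE; set w : state := delta_mx i 0.
transitivity (dot w (energy_gradient u)); last first.
  by rewrite /dot trmx_delta -rowE mxE.
rewrite [in RHS](stateE w) /energy_gradient !dot_col_mx dot0r add0r.
apply: (derive_quadratic (b := 2^-1 * dot (st_V w) (W *m st_V w)
   + 2^-1 * dot (st_e w) (M1 *m st_e w) + 2^-1 * dot (st_b w) (M2 *m st_b w))) => h.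
have lV : st_V (h *: w + u) = h *: st_V w + st_V u by rewrite /st_V !linearD !linearZ.
have le : st_e (h *: w + u) = h *: st_e w + st_e u by rewrite /st_e !linearD !linearZ.
have lb : st_b (h *: w + u) = h *: st_b w + st_b u by rewrite /st_b !linearD !linearZ.
by rewrite !hamiltonianE lV le lb !dot_quadratic ?W_sym //; field.
Qed.

Lemma st_col (x y : 'cV[R]_(\sum_(k < Np) 3)) e b (u :=
  col_mx (col_mx x y) (col_mx e b)) :
  [/\ st_Xi (p := p) (n := n) u = x, st_V (p := p) (n := n) u = y,
      st_e (p := p) (n := n) (Np := Np) u = e & st_b (p := p) (n := n) (Np := Np) u =
        b].
Proof. by split; rewrite /st_Xi /st_V /st_e /st_b ?col_mxKu ?col_mxKd ?col_mxKu
  ?col_mxKd. Qed.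

(** The invertibility of M_1 serves to divide by it in the equation for e. *)
Lemma motion_poisson (u du : state) :
  equations_of_motion F omega q m C u du <-> du = J u *m gradient H u.
Proof.
have [Wu _] := Wm_inv homega hm.
have WqE : W_qm q m *m W = W_q omega q.
  rewrite /W_qm /W_m mul_mxdiag; apply: eq_mxdiag => k.
  rewrite -scalar_mxM; congr (_%:M); field.
  by rewrite gt_eqF.
have [gX gV ge gb] := st_col 0 (W *m st_V u) (M1 *m st_e u) (M2 *m st_b u).
rewrite gradient_hamiltonian poisson_mul // /inv_mass_e /energy_gradient gX gV ge gb.
rewrite mulmx0 !mulKmx // mulmx0 oppr0 add0r [W_qm q m *m (W *m _)]mulmxA WqE.
set L := LL1 p n _; set N := NN _ _; set B := BB _ _.
split=> [[eX eV ee eb]|->].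
  rewrite [LHS]stateE eX eV eb; congr (col_mx (col_mx _ _) (col_mx _ _)).
    by rewrite -/L -/N -/B -!mulmxA -mulmxDr -mulmxDr [in RHS]addrC.
  rewrite -[LHS](mulKmx M1_unit) ee -[in RHS]mulmxN -[in RHS]mulmxDr [in RHS]addrC
    !mulmxA.
  by [].
rewrite /equations_of_motion -/L -/N -/B.
have [-> -> -> ->] := st_col (N^T *m st_V u)
  (W_qm q m *m (N *m (B *m (N^T *m st_V u))) + W_qm q m *m (N *m (L *m st_e u)))
  (- (invmx M1 *m (L^T *m (N^T *m (W_q omega q *m st_V u))))
   + invmx M1 *m (C^T *m (M2 *m st_b u)))
  (- (C *m st_e u)).
split=> //.
  by rewrite -!mulmxA -mulmxDr -mulmxDr [in RHS]addrC.
by rewrite mulmxDr mulmxN !mulKVmx // addrC !mulmxA.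
Qed.

Lemma ord3_add : ((0 + 1 = 1 :> 'I_3)%R * (0 + 2 = 1 + 1 :> 'I_3)%R *
  (1 + 1 + 1 = 0 :> 'I_3)%R * (1 + 2 = 0 :> 'I_3)%R * (1 + 1 + 2 = 1 :> 'I_3)%R)%type.
Proof. by do ! split; exact: val_inj. Qed.

Lemma rot_mx_skew (B : 'cV[R]_3) : (rot_mx B)^T = - rot_mx B.
Proof.
apply/matrixP => i j; rewrite !mxE.
by move: i j; do 2! (apply: ord3); rewrite -!val_eqE /= ?ord3_add ?oppr0 ?opprK.
Qed.

Lemma charged_rot_skew k u x y : dot x (charged_rot q m k u *m y) =
  - dot y (charged_rot (p := p) (n := n) q m k u *m x).
Proof.
rewrite [RHS](congr1 -%R (dotC _ _)) dot_mull linearZ /= rot_mx_skew scalerN mulNmx.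
by rewrite dotNr opprK.
Qed.

Lemma poisson_skew u : (J u)^T = - J u.
Proof.
have JE i j : J u i j = dot (delta_mx i 0) (J u *m delta_mx j 0).
  by rewrite /dot trmx_delta -rowE -colE !mxE.
apply/matrixP => i j; rewrite mxE [RHS]mxE !JE !poisson_form //.
rewrite opprD opprB -sumrN; congr (_ + _); apply: eq_bigr => k _.
rewrite /particle_form.
rewrite (charged_rot_skew k u (inv_DF F k u *m v_part k (delta_mx j 0))); ring.
Qed.

End EquationsOfMotion.

(** * Derivatives of scalar products, curl and divergence *)

Section DerivativeTools.
Context {R : realType}.

Context {V : normedModType R}.

Lemma mx_differentiable_differentiable m n (A : V -> 'M[R]_(m, n)) x :
  mx_differentiable A x -> differentiable A x.
Proof.
move=> dA.
rewrite (_ : A = \sum_(i < m) \sum_(j < n) (fun y => A y i j *: delta_mx i j));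
  last first.
  apply/funext => y; rewrite {1}[A y]matrix_sum_delta fct_sumE.
  by apply: eq_bigr => i _; rewrite fct_sumE.
apply: differentiable_sum => i; apply: differentiable_sum => j.
by apply: differentiableZl; exact: dA.
Qed.

Lemma derive_addv (f : V -> R) x v w : differentiable f x ->
  'D_(v + w) f x = 'D_v f x + 'D_w f x.
Proof. by move=> df; rewrite !deriveE // linearD. Qed.

Lemma derive_scalev (f : V -> R) x c v : differentiable f x ->
  'D_(c *: v) f x = c * 'D_v f x.
Proof. by move=> df; rewrite !deriveE // linearZ. Qed.

Lemma derive_mxe_add m n (A : V -> 'M[R]_(m, n)) x v w : mx_differentiable A x ->
  derive_mxe A x (v + w) = derive_mxe A x v + derive_mxe A x w.
Proof. by move=> dA; apply/matrixP => i j; rewrite [RHS]mxE !derive_mxeP;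
  exact: derive_addv. Qed.

Lemma derive_mxe_scale m n (A : V -> 'M[R]_(m, n)) x c v : mx_differentiable A x ->
  derive_mxe A x (c *: v) = c *: derive_mxe A x v.
Proof. by move=> dA; apply/matrixP => i j; rewrite [RHS]mxE !derive_mxeP;
  exact: derive_scalev. Qed.

Lemma derive_dot n (P Q : V -> 'cV[R]_n) x w :
  mx_differentiable P x -> mx_differentiable Q x ->
  differentiable (fun v => dot (P v) (Q v)) x /\
  'D_w (fun v => dot (P v) (Q v)) x =
    dot (derive_mxe P x w) (Q x) + dot (P x) (derive_mxe Q x w).
Proof.
move=> dP dQ; have dPt := differentiable_trmx dP.
split; first exact: (differentiable_mulmx dPt dQ).
have /matrixP/(_ 0 0) := derive_mulmx w dPt dQ.
rewrite derive_mxeP => ->; rewrite mxE; congr (_ + _).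
rewrite /dot; congr ((_ *m _) 0 0); apply/matrixP => i j.
rewrite [RHS]mxE !derive_mxeP.
by congr ('D_w _ x); apply/funext => y; rewrite mxE.
Qed.

Lemma cst_differentiable m n (A : 'M[R]_(m, n)) x : mx_differentiable (fun _ : V =>
  A) x.
Proof. by move=> i j; exact: differentiable_cst. Qed.

Lemma derive_mulmx_cst m n k (A : V -> 'M[R]_(m, n)) (B : 'M[R]_(n, k)) x w :
  mx_differentiable A x ->
  mx_differentiable (fun v => A v *m B) x /\
  derive_mxe (fun v => A v *m B) x w = derive_mxe A x w *m B.
Proof.
move=> dA; split; first exact: (differentiable_mulmx dA (cst_differentiable B x)).
rewrite (derive_mulmx w dA (cst_differentiable B x)).
by rewrite derive_mxe_cst mulmx0 addr0.
Qed.

Lemma comp_mx_differentiable (V' : normedModType R) (L : V' -> V) m n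
    (A : V -> 'M[R]_(m, n)) x :
  differentiable L x -> mx_differentiable A (L x) -> mx_differentiable (A \o L) x.
Proof. by move=> dL dA i j; exact: (differentiable_comp dL (dA i j)). Qed.

End DerivativeTools.

Section FieldIdentities.
Context {R : realType}.

Lemma sum3 (f : 'I_3 -> R) : \sum_i f i = f 0 + f 1 + f (1 + 1).
Proof.
rewrite !big_ord_recl big_ord0 addr0 addrA.
by congr (f _ + f _ + f _); exact: val_inj.
Qed.

Lemma dot3 (x y : 'cV[R]_3) :
  dot x y = x 0 0 * y 0 0 + x 1 0 * y 1 0 + x (1 + 1) 0 * y (1 + 1) 0.
Proof. by rewrite /dot mxE sum3 !mxE. Qed.

Lemma dot_rot (B x y : 'cV[R]_3) : dot x (rot_mx B *m y) =
  B 0 0 * (x 1 0 * y (1 + 1) 0 - x (1 + 1) 0 * y 1 0)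
  + B 1 0 * (x (1 + 1) 0 * y 0 0 - x 0 0 * y (1 + 1) 0)
  + B (1 + 1) 0 * (x 0 0 * y 1 0 - x 1 0 * y 0 0).
Proof.
rewrite dot3 !mxE !sum3 !mxE -!val_eqE /= ?ord3_add; ring.
Qed.

Lemma derive_partial (E : 'rV[R]_3 -> 'cV[R]_3) xi (a : 'cV[R]_3) i :
  mx_differentiable E xi ->
  derive_mxe E xi a^T i 0 = \sum_j a j 0 * partial E j i xi.
Proof.
move=> dE; rewrite derive_mxeP [a^T]row_sum_delta /partial !deriveE //.
rewrite linear_sum; apply: eq_bigr => j _.
by rewrite linearZ /= mxE deriveE.
Qed.

(** The exterior derivative of the 1-form E, evaluated at a and b. *)
Lemma curl_identity (E : 'rV[R]_3 -> 'cV[R]_3) xi (a b : 'cV[R]_3) :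
  mx_differentiable E xi ->
  dot b (derive_mxe E xi a^T) - dot a (derive_mxe E xi b^T) =
  dot a (rot_mx (curl E xi) *m b).
Proof.
move=> dE; have DE v i := derive_partial v i dE.
have CE i : curl E xi i 0 = partial E (i + 1) (i + 2) xi - partial E (i + 2) (i + 1) xi.
  by rewrite mxE.
have [P PE] : exists P, forall j i, partial E j i xi = P j i.
  by exists (fun j i => partial E j i xi).
rewrite dot_rot !dot3 !DE !CE !sum3 !PE ?ord3_add; ring.
Qed.

(** The exterior derivative of the 2-form E, evaluated at a, b and c: it is the
    divergence of E times det (a, b, c). *)
Lemma divergence_identity (E : 'rV[R]_3 -> 'cV[R]_3) xi (a b c : 'cV[R]_3) :
  mx_differentiable E xi -> divergence E xi = 0 ->
  dot a (rot_mx (derive_mxe E xi c^T) *m b) +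
  dot b (rot_mx (derive_mxe E xi a^T) *m c) +
  dot c (rot_mx (derive_mxe E xi b^T) *m a) = 0.
Proof.
move=> dE; rewrite /divergence sum3 => dv.
have DE v i := derive_partial v i dE.
have [P PE] : exists P, forall j i, partial E j i xi = P j i.
  by exists (fun j i => partial E j i xi).
rewrite !dot_rot !DE !sum3 !PE in dv *.
transitivity ((P 0 0 + P 1 1 + P (1 + 1) (1 + 1)) *
  (c 0 0 * (a 1 0 * b (1 + 1) 0 - a (1 + 1) 0 * b 1 0)
  + c 1 0 * (a (1 + 1) 0 * b 0 0 - a 0 0 * b (1 + 1) 0)
  + c (1 + 1) 0 * (a 0 0 * b 1 0 - a 1 0 * b 0 0))); last by rewrite dv mul0r.
ring.
Qed.

End FieldIdentities.

(** * The Jacobi identity *)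

Section Jacobi.
Context {R : realType} (p : nat) (n : 'I_3 -> nat).
Context (F : 'rV[R]_3 -> 'rV[R]_3) (Omega : set 'rV[R]_3).
Context (Np : nat) (omega q m : 'I_Np -> R).
Context (C : 'M[R]_(dim2 p n, dim1 p n)) (D : 'M[R]_(dim3 p n, dim2 p n)).
Hypotheses (homega : forall k, omega k != 0) (hm : forall k, 0 < m k).
Hypotheses (M1_unit : mass1 p n F \in unitmx) (M1_sym : (mass1 p n F)^T = mass1 p n F).
Hypotheses (hF : coordinate_map F Omega) (hC : discrete_curl C) (hD : discrete_div D).

Local Notation d1 := (dim1 p n).
Local Notation d2 := (dim2 p n).
Local Notation state := 'cV[R]_(state_dim p n Np).
Local Notation J := (poisson_mx F omega q m C).
Local Notation M1 := (mass1 p n F).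
Local Notation mass_e := (inv_mass_e F).

Definition particle_col (k : 'I_Np) (x : 'cV[R]_3) : 'cV[R]_(\sum_(l < Np) 3) :=
  \mxcol_(l < Np) (if l == k then x else 0).
Definition velocity_dir (k : 'I_Np) (x : 'cV[R]_3) : state :=
  col_mx (col_mx 0 (particle_col k x)) (col_mx 0 0).
Definition field_dir (x : 'cV[R]_d1) : state :=
  col_mx (col_mx 0 0) (col_mx x 0).

Lemma submxcol_particle k l x : submxcol (particle_col k x) l = if l == k then x else 0.
Proof. by rewrite mxcolK. Qed.

Lemma particle_posE k (v : state) : particle_pos k v = (xi_part k v)^T.
Proof. by []. Qed.

Lemma xi_partD k (v w : state) : xi_part k (v + w) = xi_part k v + xi_part k w.
Proof. by apply/matrixP => i j; rewrite !mxE. Qed.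
Lemma xi_partZ k c (v : state) : xi_part k (c *: v) = c *: xi_part k v.
Proof. by apply/matrixP => i j; rewrite !mxE. Qed.
Lemma st_bD (v w : state) : st_b (v + w) = st_b v + st_b w.
Proof. by rewrite /st_b !linearD. Qed.
Lemma st_bZ c (v : state) : st_b (c *: v) = c *: st_b v.
Proof. by rewrite /st_b !linearZ. Qed.

Lemma particle_pos_line k (v w : state) (h : R) : particle_pos k (h *: w + v) =
  h *: (xi_part k w)^T + particle_pos k v.
Proof. by rewrite !particle_posE xi_partD xi_partZ linearD linearZ. Qed.

Lemma particle_pos_differentiable k (u : state) : differentiable (particle_pos k) u.
Proof.
apply: mx_differentiable_differentiable => i j.
rewrite (_ : (fun v => _) = fun v : state =>
   v (lshift _ (lshift _ (tagnat.Rank k j))) 0); first exact: differentiable_coord.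
by apply/funext => v; rewrite !mxE ord1.
Qed.

(** The direction in phase space that displaces particle k by x and moves
    nothing else. *)
Definition position_dir (k : 'I_Np) (x : 'cV[R]_3) : state :=
  \sum_j x j 0 *: col_mx (col_mx (particle_col k (delta_mx j 0)) 0) (col_mx 0 0).

Lemma xi_part_position_dir k x : xi_part k (position_dir k x) = x.
Proof.
have xi_part0 : xi_part k (0 : state) = 0 by apply/matrixP => i j; rewrite !mxE.
rewrite /position_dir (big_morph (xi_part k) (xi_partD k) xi_part0).
rewrite [RHS]matrix_sum_delta; apply: eq_bigr => j _.
rewrite xi_partZ big_ord1; congr (_ *: _).
by rewrite /xi_part /st_Xi !col_mxKu submxcol_particle eqxx.
Qed.

Lemma st_b_position_dir k x : st_b (position_dir k x) = 0.
Proof.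
have b0 : st_b (0 : state) = 0 by apply/matrixP => i j; rewrite !mxE.
rewrite /position_dir (big_morph (@st_b _ _ _ _) st_bD b0) big1 // => j _.
by rewrite st_bZ /st_b !col_mxKd scaler0.
Qed.

(** A section of [particle_pos k] through u, by which differentiability at a state
    gives differentiability at the position of particle k. *)
Definition move_particle (k : 'I_Np) (u : state) (x : 'rV[R]_3) : state :=
  u + position_dir k (x - particle_pos k u)^T.

Lemma particle_pos_move k u x : particle_pos k (move_particle k u x) = x.
Proof.
apply: trmx_inj; rewrite particle_posE trmxK xi_partD xi_part_position_dir
  particle_posE linearB /= trmxK.
by rewrite addrC subrK.
Qed.

Lemma st_b_move k u x : st_b (move_particle k u x) = st_b u.
Proof. by rewrite st_bD st_b_position_dir addr0. Qed.

Lemma move_id k u : move_particle k u (particle_pos k u) = u.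
Proof.
rewrite /move_particle subrr /position_dir big1 ?addr0 // => j _.
by rewrite !mxE scale0r.
Qed.

Lemma move_differentiable k u x : differentiable (move_particle k u) x.
Proof.
apply: differentiableD; first exact: differentiable_cst.
rewrite (_ : (fun x => _) = \sum_(j < 3) (fun x : 'rV[R]_3 =>
  (x 0 j - particle_pos k u 0 j) *:
   (col_mx (col_mx (particle_col k (delta_mx j 0)) 0) (col_mx 0 0) : state))).
  apply: differentiable_sum => j; apply: differentiableZl.
  by apply: differentiableB; [exact: differentiable_coord|exact: differentiable_cst].
apply/funext => y; rewrite fct_sumE; apply: eq_bigr => j _.
by rewrite !mxE.
Qed.

Lemma mx_differentiable_restrict a b (G : 'rV[R]_3 -> 'M[R]_(a, b)) (H : state
  -> 'M[R]_(a, b)) k u :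
  (forall x, G x = H (move_particle k u x)) -> mx_differentiable H u ->
  mx_differentiable G (particle_pos k u).
Proof.
move=> GH dH; rewrite (_ : G = H \o move_particle k u); last exact/funext.
apply: comp_mx_differentiable; first exact: move_differentiable.
by rewrite move_id.
Qed.

Section AtState.
Context (u : state).
Hypotheses (adm : admissible D u) (dJ : forall i j, differentiable (fun v =>
  J v i j) u).

Lemma form_differentiable a b : differentiable (fun v => dot a (J v *m b)) u.
Proof.
have dM : mx_differentiable J u by move=> i j; exact: dJ.
have := differentiable_mulmx (cst_differentiable a^T u)
  (differentiable_mulmx dM (cst_differentiable b u)).
exact.
Qed.

Lemma cube_pos k : cube (particle_pos k u).
Proof. by case: adm => + _; apply. Qed.

Lemma DF_pos_differentiable k : mx_differentiable (fun v => DF F (particle_pos k v)) u.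
Proof.
apply: comp_mx_differentiable; first exact: particle_pos_differentiable.
exact: (cube_DF_differentiable hF (cube_pos k)).
Qed.

Lemma inv_DF_differentiable k : mx_differentiable (inv_DF F k) u.
Proof.
apply: differentiable_invmx; first exact: DF_pos_differentiable.
exact: (DF_unit hF (cube_pos k)).
Qed.

Lemma near_DF_unit k : \near u, DF F (particle_pos k u) \in unitmx.
Proof.
apply: near_unitmx; first exact: DF_pos_differentiable.
exact: (DF_unit hF (cube_pos k)).
Qed.

Lemma v_part_velocity k l x : v_part l (velocity_dir k x) = if l == k then x else 0.
Proof. by rewrite /v_part /st_V /velocity_dir col_mxKu col_mxKd submxcol_particle. Qed.

Lemma xi_part_velocity k l x : xi_part l (velocity_dir k x) = 0.
Proof. by rewrite /xi_part /st_Xi /velocity_dir !col_mxKu submxcol0. Qed.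

Lemma inv_mass_e_velocity k x : mass_e (velocity_dir k x) = 0.
Proof. by rewrite /inv_mass_e /st_e /velocity_dir col_mxKd col_mxKu mulmx0. Qed.

Lemma b_velocity k x : st_b (velocity_dir k x) = 0.
Proof. by rewrite /st_b /velocity_dir !col_mxKd. Qed.

Lemma v_part_field l x : v_part l (field_dir x) = 0.
Proof. by rewrite /v_part /st_V /field_dir col_mxKu col_mxKd submxcol0. Qed.

Lemma xi_part_field l x : xi_part l (field_dir x) = 0.
Proof. by rewrite /xi_part /st_Xi /field_dir !col_mxKu submxcol0. Qed.

Lemma inv_mass_e_field x : mass_e (field_dir (M1 *m x)) = x.
Proof. by rewrite /inv_mass_e /st_e /field_dir col_mxKd col_mxKu mulKmx. Qed.

Lemma b_field x : st_b (field_dir x) = 0.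
Proof. by rewrite /st_b /field_dir !col_mxKd. Qed.

Lemma dot0l d (x : 'cV[R]_d) : dot 0 x = 0.
Proof. by rewrite dotC dot0r. Qed.

Lemma form_velocity k v x y :
  dot (velocity_dir k x) (J v *m velocity_dir k y) =
  (omega k * m k)^-1 *
    dot (inv_DF F k v *m x) (charged_rot q m k v *m (inv_DF F k v *m y)).
Proof.
rewrite poisson_form // !inv_mass_e_velocity !dot0l subr0 addr0 (bigD1 k) //= big1
  ?addr0 => [|l lk].
  by rewrite /particle_form !v_part_velocity eqxx !xi_part_velocity
    !inv_mass_e_velocity !mulmx0 !(dot0l, dot0r) !(subr0, mulr0, add0r, addr0).
by rewrite /particle_form !v_part_velocity (negbTE lk) !xi_part_velocity
  !inv_mass_e_velocity !mulmx0 !(dot0l, dot0r) !(subr0, mulr0, add0r).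
Qed.

Lemma form_field k v x e :
  dot (velocity_dir k x) (J v *m field_dir (M1 *m e)) =
  dot (inv_DF F k v *m x) (charged_Lambda1 q m k v *m e).
Proof.
rewrite poisson_form // !inv_mass_e_velocity b_velocity b_field !mulmx0 !dot0r subr0
  addr0.
rewrite (bigD1 k) //= big1 ?addr0 => [|l lk].
  by rewrite /particle_form !v_part_velocity !v_part_field eqxx !xi_part_velocity
    !xi_part_field !inv_mass_e_velocity !inv_mass_e_field !mulmx0 !(dot0l, dot0r)
      !(subr0, mulr0, add0r, addr0).
by rewrite /particle_form !v_part_velocity !v_part_field (negbTE lk)
  !xi_part_velocity !xi_part_field !inv_mass_e_velocity !inv_mass_e_field !mulmx0
    !(dot0l, dot0r) !(subr0, mulr0, add0r).
Qed.

Lemma dot_delta a b (M : 'M[R]_(a, b)) i j : dot (delta_mx i 0) (M *m delta_mx j 0) =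
  M i j.
Proof. by rewrite /dot trmx_delta -rowE -colE !mxE. Qed.

(** The block of J that couples velocities to e is N charged_Lambda1 M_1^-1, and
    M_1 and N are invertible, the latter with a differentiable inverse near u. *)
Lemma charged_Lambda1_differentiable k : mx_differentiable (charged_Lambda1 (p :=
  p) (n := n) q m k) u.
Proof.
have dG : mx_differentiable (fun v => (inv_DF F k v)^T *m charged_Lambda1 q m k v) u.
  move=> i j; have := form_differentiable (velocity_dir k (delta_mx i 0))
    (field_dir (M1 *m delta_mx j 0)).
  rewrite (_ : (fun v => dot _ _) =
    (fun v => ((inv_DF F k v)^T *m charged_Lambda1 q m k v) i j)) //.
  by apply/funext => v; rewrite form_field dot_mull mulmxA dot_delta.
have dD := differentiable_mulmx (differentiable_trmx (DF_pos_differentiable k)) dG.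
move=> i j; apply: near_eq_differentiable (dD i j).
have nA := near_DF_unit k.
near=> v; rewrite mulmxA -trmx_mul /inv_DF mulVmx ?trmx1 ?mul1mx //.
exact: (near nA v).
Unshelve. all: by end_near. Qed.

(** The block of J that couples velocities is N charged_rot N^T up to a nonzero
    factor, and N is invertible with a differentiable inverse near u. *)
Lemma charged_rot_differentiable k : mx_differentiable (charged_rot (p := p) (n :=
  n) q m k) u.
Proof.
have s0 : omega k * m k != 0 by rewrite mulf_neq0 // gt_eqF.
have dG : mx_differentiable
    (fun v => (inv_DF F k v)^T *m charged_rot q m k v *m inv_DF F k v) u.
  move=> i j; have := form_differentiable (velocity_dir k (delta_mx i 0))
    (velocity_dir k (delta_mx j 0)).
  move=> /(differentiableZ (omega k * m k)).
  rewrite (_ : _ *: _ = (fun v =>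
    ((inv_DF F k v)^T *m charged_rot q m k v *m inv_DF F k v) i j)) //.
  apply/funext => v; rewrite -[LHS]/(omega k * m k * dot _ _) form_velocity mulVKf //.
  by rewrite dot_mull !mulmxA dot_delta.
have dD := differentiable_mulmx (differentiable_mulmx (differentiable_trmx
  (DF_pos_differentiable k)) dG)
  (DF_pos_differentiable k).
move=> i j; apply: near_eq_differentiable (dD i j).
have nA := near_DF_unit k.
near=> v.
have uA : DF F (particle_pos k v) \in unitmx by exact: (near nA v).
by rewrite !mulmxA -trmx_mul /inv_DF mulVmx // trmx1 mul1mx mulmxKV.
Unshelve. all: by end_near. Qed.

Lemma derive_inv_DF k w : derive_mxe (inv_DF F k) u w =
  derive_mxe (fun z => invmx (DF F z)) (particle_pos k u) (xi_part k w)^T.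
Proof.
apply/matrixP => i j; rewrite !derive_mxeP; apply: (proj1 (derive_line_eq _)) => h.
by rewrite /inv_DF particle_pos_line.
Qed.

Lemma derive_mulc (f : state -> R) c w : differentiable f u ->
  'D_w (fun v => c * f v) u = c * 'D_w f u.
Proof. by move=> df; exact: (deriveZ c (diff_derivable df)). Qed.

Section Charged.
Context (k : 'I_Np).
Hypothesis qm0 : q k / m k != 0.

Lemma electric_differentiable (e : 'cV[R]_d1) :
  mx_differentiable (fun x => Lambda1 p n x *m e) (particle_pos k u).
Proof.
apply: (mx_differentiable_restrict (H := fun v =>
  (q k / m k)^-1 *: (charged_Lambda1 q m k v *m e))) => [x|].
  by rewrite /charged_Lambda1 particle_pos_move -scalemxAl scalerA mulVf // scale1r.
apply: differentiable_scalemx; first exact: differentiable_cst.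
exact: (differentiable_mulmx (charged_Lambda1_differentiable k) (cst_differentiable e
  u)).
Qed.

Lemma derive_charged_Lambda1 w (e : 'cV[R]_d1) : derive_mxe (charged_Lambda1 q m k) u
  w *m e =
  (q k / m k) *: derive_mxe (fun x => Lambda1 p n x *m e) (particle_pos k u)
    (xi_part k w)^T.
Proof.
have [_ <-] := derive_mulmx_cst e w (charged_Lambda1_differentiable k).
apply/matrixP => i j; rewrite [RHS]mxE !derive_mxeP.
transitivity (q k / m k * 'D_w (fun v => (Lambda1 p n (particle_pos k v) *m e) i j)
  u); last first.
  by congr (_ * _); apply: (proj1 (derive_line_eq _)) => h; rewrite particle_pos_line.
rewrite -derive_mulc; last first.
  exact: (comp_mx_differentiable (particle_pos_differentiable k u)
    (electric_differentiable e) i j).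
congr ('D_w _ u); apply/funext => v.
by rewrite /charged_Lambda1 -scalemxAl mxE.
Qed.

Local Notation g := (fun v : state => Lambda2 p n (particle_pos k v) *m st_b v).

Lemma magnetic_differentiable : mx_differentiable g u.
Proof.
move=> i j; rewrite ord1.
(* Component i of the field is entry (i + 1, i + 2) of its rotation matrix. *)
rewrite (_ : (fun v => _) = fun v => (q k / m k)^-1 * charged_rot q m k v (i + 1) (i
  + 1 + 1)).
  apply: differentiable_mulr;
    [exact: differentiable_cst|exact: charged_rot_differentiable].
apply/funext => v; rewrite [charged_rot _ _ _ _ _ _]mxE mulKf // [rot_mx _ _ _]mxE eqxx.
by congr (fun_of_matrix _ _ 0); rewrite -addrA -[LHS]addr0; congr (_ + _);
  exact: val_inj.
Qed.

(** The direction w is the sum of a displacement of particle k, along which b is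
    fixed, and of a direction along which the particle does not move and the
    field is affine.  The two derivatives add up because the field is
    differentiable jointly in the position and in b. *)
Lemma derive_magnetic w : derive_mxe g u w =
  derive_mxe (fun x => Lambda2 p n x *m st_b u) (particle_pos k u) (xi_part k w)^T
  + Lambda2 p n (particle_pos k u) *m st_b w.
Proof.
rewrite -{1}[w](subrK (position_dir k (xi_part k w))) addrC.
rewrite (derive_mxe_add _ _ magnetic_differentiable); congr (_ + _).
  apply/matrixP => i j; rewrite !derive_mxeP; apply: (proj1 (derive_line_eq _)) => h.
  by rewrite particle_pos_line xi_part_position_dir st_bD st_bZ st_b_position_dir
    scaler0 add0r.
apply/matrixP => i j; rewrite derive_mxeP; apply: (derive_quadratic (b := 0)) => h.
rewrite mulr0 addr0 particle_pos_line.
have -> : xi_part k (w - position_dir k (xi_part k w)) = 0.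
  by rewrite xi_partD -scaleN1r xi_partZ xi_part_position_dir scaleN1r subrr.
rewrite trmx0 scaler0 add0r st_bD st_bZ st_bD -scaleN1r st_bZ st_b_position_dir.
by rewrite scaler0 addr0 mulmxDr -scalemxAr addrC !mxE.
Qed.

Lemma derive_charged_rot w : derive_mxe (charged_rot q m k) u w =
  (q k / m k) *: rot_mx (derive_mxe g u w).
Proof.
apply/matrixP => i j; rewrite derive_mxeP [RHS]mxE [rot_mx _ _ _]mxE.
rewrite (_ : (fun v => _) = fun v => q k / m k * rot_mx (g v) i j); last first.
  by apply/funext => v; rewrite [LHS]mxE.
case: (eqVneq j (i + 1)) => ji.
  rewrite derive_mxeP -derive_mulc; last exact: magnetic_differentiable.
  by congr ('D_w _ u); apply/funext => v; rewrite [rot_mx _ _ _]mxE ji eqxx.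
case: (eqVneq j (i + 2)) => ji'.
  rewrite derive_mxeP mulrN -mulNr -derive_mulc; last exact: magnetic_differentiable.
  congr ('D_w _ u); apply/funext => v; rewrite [rot_mx _ _ _]mxE (negbTE ji) ji' eqxx.
  by rewrite mulrN mulNr.
rewrite mulr0 -[RHS](derive_cst 0 u w); congr ('D_w _ u); apply/funext => v.
by rewrite [rot_mx _ _ _]mxE (negbTE ji) (negbTE ji') mulr0.
Qed.

End Charged.

Lemma charged_Lambda1_0 k : q k / m k = 0 -> charged_Lambda1 (p := p) (n := n) q m k
  = fun=> 0.
Proof. by move=> k0; apply/funext => v; rewrite /charged_Lambda1 k0 scale0r. Qed.

Lemma charged_rot_0 k : q k / m k = 0 -> charged_rot (p := p) (n := n) q m k = fun=> 0.
Proof. by move=> k0; apply/funext => v; rewrite /charged_rot k0 scale0r. Qed.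

(** The discrete curl identity, for displacements of the particle along a and b. *)
Lemma faraday_identity k s (a b : 'cV[R]_3) (wa wb : state) e :
  xi_part k wa = s *: a -> xi_part k wb = s *: b ->
  dot b (derive_mxe (charged_Lambda1 q m k) u wa *m e)
    - dot a (derive_mxe (charged_Lambda1 q m k) u wb *m e) =
  s * (q k / m k * dot a (rot_mx (Lambda2 p n (particle_pos k u) *m (C *m e)) *m b)).
Proof.
move=> Xa Xb; have [k0|k0] := eqVneq (q k / m k) 0.
  by rewrite charged_Lambda1_0 // !derive_mxe_cst !mul0mx !dot0r k0 mul0r mulr0 subr0.
have dE := electric_differentiable k0 e.
have dKL w c : xi_part k w = s *: c -> derive_mxe (charged_Lambda1 q m k) u w *m e =
    (q k / m k * s) *: derive_mxe (fun x => Lambda1 p n x *m e) (particle_pos k u) c^T.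
  by move=> Xw; rewrite (derive_charged_Lambda1 k0) Xw linearZ /= (derive_mxe_scale _
    _ dE) scalerA.
rewrite (dKL _ _ Xa).
rewrite (dKL _ _ Xb).
rewrite (dotZr _ b) (dotZr _ a) -mulrBr.
rewrite (curl_identity a b dE).
rewrite (hC (cube_pos k) (mx_differentiable_differentiable dE)); ring.
Qed.

(** The derivatives of B~ with respect to the position cancel because div B = 0;
    those with respect to b remain. *)
Lemma magnetic_identity k s (a b c : 'cV[R]_3) (wa wb wc : state) ea eb ec :
  xi_part k wa = s *: a -> xi_part k wb = s *: b -> xi_part k wc = s *: c ->
  st_b wa = - (C *m ea) -> st_b wb = - (C *m eb) -> st_b wc = - (C *m ec) ->
  let K e x y := q k / m k *
    dot x (rot_mx (Lambda2 p n (particle_pos k u) *m (C *m e)) *m y) in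
  dot a (derive_mxe (charged_rot q m k) u wc *m b)
    + dot b (derive_mxe (charged_rot q m k) u wa *m c)
  + dot c (derive_mxe (charged_rot q m k) u wb *m a) =
    - (K ec a b + K ea b c + K eb c a).
Proof.
move=> Xa Xb Xc ba bb bc K; have [k0|k0] := eqVneq (q k / m k) 0.
  by rewrite charged_rot_0 // !derive_mxe_cst !mul0mx !dot0r /K k0 !mul0r !addr0 oppr0.
have dE : mx_differentiable (fun x => Lambda2 p n x *m st_b u) (particle_pos k u).
  apply: (mx_differentiable_restrict
    (H := fun v => Lambda2 p n (particle_pos k v) *m st_b v)) => [x|].
    by rewrite particle_pos_move st_b_move.
  exact: (magnetic_differentiable k0).
have div0 : divergence (fun x => Lambda2 p n x *m st_b u) (particle_pos k u) = 0.
  rewrite (hD (cube_pos k) (mx_differentiable_differentiable dE)).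
  by case: adm => _ ->; rewrite mulmx0 mxE.
have rotD (B B' : 'cV[R]_3) x y : dot x (rot_mx (B + B') *m y) =
    dot x (rot_mx B *m y) + dot x (rot_mx B' *m y).
  by rewrite !dot_rot ![(B + B') _ _]mxE; ring.
have rotZ c' (B : 'cV[R]_3) x y : dot x (rot_mx (c' *: B) *m y) =
    c' * dot x (rot_mx B *m y).
  by rewrite !dot_rot ![(c' *: B) _ _]mxE; ring.
have KBE w x y : dot x (derive_mxe (charged_rot q m k) u w *m y) = q k / m k *
   (dot x (rot_mx (derive_mxe (fun x => Lambda2 p n x *m st_b u) (particle_pos k u)
     (xi_part k w)^T) *m y)
   + dot x (rot_mx (Lambda2 p n (particle_pos k u) *m st_b w) *m y)).
  by rewrite (derive_charged_rot k0) -scalemxAl dotZr (derive_magnetic k0) rotD.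
have KBs w x y z ex : xi_part k w = s *: z -> st_b w = - (C *m ex) ->
    dot x (derive_mxe (charged_rot q m k) u w *m y) = q k / m k *
   (s * dot x (rot_mx (derive_mxe (fun x =>
     Lambda2 p n x *m st_b u) (particle_pos k u) z^T) *m y)
   - dot x (rot_mx (Lambda2 p n (particle_pos k u) *m (C *m ex)) *m y)).
  move=> Xw bw; rewrite KBE Xw bw linearZ /= (derive_mxe_scale _ _ dE) rotZ mulmxN.
  by rewrite -scaleN1r rotZ mulN1r.
rewrite (KBs _ _ _ _ _ Xa ba) (KBs _ _ _ _ _ Xb bb) (KBs _ _ _ _ _ Xc bc) /K.
have := divergence_identity a b c dE div0.
set x := dot a _; set y := dot b _; set z := dot c _ => xyz.
have -> : x = - (y + z) by apply/eqP; rewrite -addr_eq0 addrA xyz.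
ring.
Qed.

(** The derivative of [particle_form] along w, by the product rule. *)
Definition particle_derivative k (a b w : state) : R :=
  let s := (omega k * m k)^-1 in
  let A := inv_DF F k u in let dA := derive_mxe (inv_DF F k) u w in
  let B := charged_rot q m k u in let dB := derive_mxe (charged_rot q m k) u w in
  let L := charged_Lambda1 q m k u in
  let dL := derive_mxe (charged_Lambda1 q m k) u w in
  s * (dot (xi_part k a) (dA *m v_part k b) - dot (xi_part k b) (dA *m v_part k a))
  + s * (dot (dA *m v_part k a) (B *m (A *m v_part k b))
         + dot (A *m v_part k a) (dB *m (A *m v_part k b))
         + dot (A *m v_part k a) (B *m (dA *m v_part k b)))
  + (dot (dA *m v_part k a) (L *m mass_e b)
     + dot (A *m v_part k a) (dL *m mass_e b)
     - (dot (dA *m v_part k b) (L *m mass_e a)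
        + dot (A *m v_part k b) (dL *m mass_e a))).

Lemma derive_particle_form k a b w :
  differentiable (fun v => particle_form F omega q m k v a b) u /\
  'D_w (fun v => particle_form F omega q m k v a b) u = particle_derivative k a b w.
Proof.
have dAx (x : 'cV[R]_3) := derive_mulmx_cst x w (inv_DF_differentiable k).
have dLe (e : 'cV[R]_d1) := derive_mulmx_cst e w (charged_Lambda1_differentiable k).
have [d1 D1] := derive_dot w (cst_differentiable (xi_part k a) u) (dAx (v_part k b)).1.
have [d2 D2] := derive_dot w (cst_differentiable (xi_part k b) u) (dAx (v_part k a)).1.
have dB := differentiable_mulmx (charged_rot_differentiable k) (dAx (v_part k b)).1.
have [d3 D3] := derive_dot w (dAx (v_part k a)).1 dB.
have [d4 D4] := derive_dot w (dAx (v_part k a)).1 (dLe (mass_e b)).1.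
have [d5 D5] := derive_dot w (dAx (v_part k b)).1 (dLe (mass_e a)).1.
set s := (omega k * m k)^-1.
have d12 := differentiableZ s (differentiableB d1 d2).
have d3' := differentiableZ s d3.
have d45 := differentiableB d4 d5.
have d := differentiableD (differentiableD d12 d3') d45.
split; first exact: d.
have dd f : differentiable f u -> derivable f u w by exact: diff_derivable.
transitivity (s * ('D_w (fun v => dot (xi_part k a) (inv_DF F k v *m v_part k b)) u
    - 'D_w (fun v => dot (xi_part k b) (inv_DF F k v *m v_part k a)) u)
  + s * 'D_w (fun v => dot (inv_DF F k v *m v_part k a)
                           (charged_rot q m k v *m (inv_DF F k v *m v_part k b))) u
  + ('D_w (fun v => dot (inv_DF F k v *m v_part k a)
                        (charged_Lambda1 q m k v *m mass_e b)) u
     - 'D_w (fun v => dot (inv_DF F k v *m v_part k b)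
                          (charged_Lambda1 q m k v *m mass_e a)) u)).
  rewrite -(deriveB (dd _ _ d1) (dd _ _ d2)) -(deriveB (dd _ _ d4) (dd _ _ d5)).
  rewrite -[s * 'D_w (_ - _) u](deriveZ s (dd _ _ (differentiableB d1 d2))).
  rewrite -[s * 'D_w _ u](deriveZ s (dd _ _ d3)).
  rewrite -(deriveD (dd _ _ d12) (dd _ _ d3')).
  rewrite -(deriveD (dd _ _ (differentiableD d12 d3')) (dd _ _ d45)).
  by [].
rewrite D1 D2 D3 D4 D5 !derive_mxe_cst !dot0l !add0r /particle_derivative.
rewrite (derive_mulmx w (charged_rot_differentiable k) (dAx (v_part k b)).1) dotDr.
by rewrite (dAx _).2 (dAx _).2 !(dLe _).2 !addrA.
Qed.

(** Along J c the particle moves in the direction A c_v / (omega m), and b in the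
    direction - C M_1^-1 c_e.  After the symmetric terms are identified and the
    identities for curl and divergence are inserted, the sum is zero by
    linearity. *)
Lemma particle_jacobi k (a b c : state) :
  particle_derivative k a b (J u *m c) + particle_derivative k b c (J u *m a)
  + particle_derivative k c a (J u *m b) = 0.
Proof.
pose s := (omega k * m k)^-1.
have XJ x : xi_part k (J u *m x) = s *: (inv_DF F k u *m v_part k x).
  rewrite poisson_mul /xi_part /st_Xi !col_mxKu.
  have [_ ->] := Wm_inv homega hm.
  rewrite tr_mxdiag !submxcol_mxdiag mul_scalar_mx -scalemxAr Nmx_T.
  by [].
have bJ x : st_b (J u *m x) = - (C *m mass_e x).
  by rewrite poisson_mul /st_b !col_mxKd.
have sym x y : derive_mxe (inv_DF F k) u (J u *m x) *m v_part k y =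
    derive_mxe (inv_DF F k) u (J u *m y) *m v_part k x.
  have dA : mx_differentiable (fun z => invmx (DF F z)) (particle_pos k u).
    apply: differentiable_invmx; last exact: (DF_unit hF (cube_pos k)).
    exact: (cube_DF_differentiable hF (cube_pos k)).
  rewrite !derive_inv_DF !XJ !linearZ /= !derive_mxe_scale // -!scalemxAl;
    congr (_ *: _).
  case: hF => -[U [oU cU sU]] _ _ J0.
  by apply: (derive_invDF_sym oU sU); [apply: cU|apply: J0]; exact: cube_pos.
have FA e := faraday_identity e (XJ a) (XJ b).
have FB e := faraday_identity e (XJ b) (XJ c).
have FC e := faraday_identity e (XJ c) (XJ a).
have := magnetic_identity (XJ a) (XJ b) (XJ c) (bJ a) (bJ b) (bJ c).
rewrite /particle_derivative -/s /=.
(* Each derivative of A is written with its two arguments in the order a, b, c. *)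
rewrite (sym c b) (sym c a) (sym b a).
set A := inv_DF F k u; set B := charged_rot q m k u; set L := charged_Lambda1 q m k u.
set sbc := derive_mxe (inv_DF F k) u (J u *m b) *m v_part k c.
set sac := derive_mxe (inv_DF F k) u (J u *m a) *m v_part k c.
set sab := derive_mxe (inv_DF F k) u (J u *m a) *m v_part k b.
rewrite (charged_rot_skew q m k u (A *m v_part k a) sbc).
rewrite (charged_rot_skew q m k u (A *m v_part k b) sac).
rewrite (charged_rot_skew q m k u (A *m v_part k c) sab).
move=> M; have sM := congr1 ( *%R s) M.
have Fc := FA (mass_e c); have Fa := FB (mass_e a); have Fb := FC (mass_e b).
lra.
Qed.

Lemma sum_derive_dir (f : state -> R) (w : state) : differentiable f u ->
  \sum_l 'D_(delta_mx l 0) f u * w l 0 = 'D_w f u.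
Proof.
move=> df; rewrite {2}[w]matrix_sum_delta deriveE // linear_sum.
apply: eq_bigr => l _; rewrite big_ord1 linearZ /= deriveE //; exact: mulrC.
Qed.

Lemma derive_form a b w : 'D_w (fun v => dot a (J v *m b)) u =
  \sum_k particle_derivative k a b w.
Proof.
pose c0 := dot (mass_e a) (C^T *m st_b b) - dot (mass_e b) (C^T *m st_b a).
rewrite (_ : (fun v => _) = (fun v => \sum_k particle_form F omega q m k v a b)
  + cst c0); last first.
  by apply/funext => v; rewrite poisson_form.
have dk k : derivable (fun v => particle_form F omega q m k v a b) u w.
  by apply: diff_derivable; exact: (derive_particle_form k a b w).1.
have [d E] := derive_bigsum dk.
rewrite (deriveD d (derivable_cst _ _ _)) E derive_cst addr0.
by apply: eq_bigr => k _; exact: (derive_particle_form k a b w).2.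
Qed.

Lemma poisson_jacobi : jacobi_at J u.
Proof.
move=> i j k.
have JE v i' j' : J v i' j' = dot (delta_mx i' 0) (J v *m delta_mx j' 0).
  by rewrite dot_delta.
have Jl l k' : J u l k' = (J u *m (delta_mx k' 0 : state)) l 0 by rewrite -colE
  [RHS]mxE.
have S a b c : \sum_l 'D_(delta_mx l 0) (fun v => J v a b) u * J u l c =
    \sum_k particle_derivative k (delta_mx a 0) (delta_mx b 0) (J u *m delta_mx c 0).
  transitivity (\sum_l 'D_(delta_mx l 0) (fun v => J v a b) u
                 * (J u *m (delta_mx c 0 : state)) l 0).
    by apply: eq_bigr => l _; congr (_ * _); exact: Jl.
  apply: (etrans (sum_derive_dir _ (dJ a b))).
  apply: (etrans _ (derive_form _ _ _)).
  have -> : (fun v => J v a b) = (fun v => dot (delta_mx a 0) (J v *m delta_mx b 0))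
    :> (state -> R).
    by apply/funext => v; exact: JE.
  by [].
rewrite !big_split /= !S -!big_split /= big1 // => l _; exact: particle_jacobi.
Qed.

End AtState.
End Jacobi.

(** * The theorem *)

Theorem proposition3p5 (R : realType)
  (F : 'rV[R]_3 -> 'rV[R]_3) (Omega : set 'rV[R]_3)
  (p : nat) (n : 'I_3 -> nat)
  (Np : nat) (omega q m : 'I_Np -> R)
  (C : 'M[R]_(dim2 p n, dim1 p n)) (D : 'M[R]_(dim3 p n, dim2 p n))
  (hF : coordinate_map F Omega)
  (hp : (0 < p)%N) (hn : forall d, (0 < n d)%N)
  (homega : forall k, omega k != 0) (hm : forall k, 0 < m k)
  (hC : discrete_curl C) (hD : discrete_div D) :
  let H := hamiltonian F omega m in
  let J := poisson_mx F omega q m C in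
  [/\ forall (T : set R) (u : R -> 'cV[R]_(state_dim p n Np)),
        open T -> (forall t, T t -> admissible D (u t)) ->
        (solution (equations_of_motion F omega q m C) T u <->
         solution (fun v dv => dv = J v *m gradient H v) T u),
      forall u, admissible D u -> (J u)^T = - J u &
      forall u, admissible D u ->
        (forall i j, differentiable (fun v => J v i j) u) ->
        jacobi_at J u].
Proof.
have M1u := mass1_unit hF hp hn.
have M1s := mass1_sym p n F; have M2s := mass2_sym p n F.
split=> [T u _ _|u _|u adm dJ].
- by split=> sol t Tt; have [du eqn] := sol t Tt; split=> //;
    apply/(motion_poisson q C homega hm M1u M1s M2s).
- exact: poisson_skew.
- exact: (poisson_jacobi homega hm M1u M1s hF hC hD adm dJ).
Qed.
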